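(* Let $R$ be a regular $F$-finite ring of characteristic $p>0$ and let $f\in R$. The descending chain of ideals $$I_1(f^{p-1})\supseteq I_2(f^{p^2-1})\supseteq I_3(f^{p^3-1})\supseteq\cdots$$ stabilizes if and only if $\frac{1}{f}$ generates $R_f$ as a $D_R$-module.
   Context: Rings are commutative. A ring $R$ of characteristic $p$ is $F$-finite if it is a finitely generated module over its subring $R^p$ of $p$-th powers; $R^{p^s}$ denotes the subring of $p^s$-th powers. Definition of $I_s(f)$ for $f\in R$, $s\ge 1$: if $R$ is a free $R^{p^s}$-module, let $\{c_1^{p^s},c_2^{p^s},\dots\}\subset R^{p^s}$ be the coordinates of $f$ with respect to some $R^{p^s}$-basis of $R$; then $I_s(f)$ is the ideal of $R$ generated by $\{c_1,c_2,\dots\}$ (it is independent of the basis). In general, $R$ regular and $F$-finite is a finite locally free $R^p$-module, so $\operatorname{Spec}R$ is covered by finitely many open affines $\operatorname{Spec}R_r$ with $R_r$ free over $R_r^p$ (hence over $R_r^{p^s}$ for every $s$), and $I_s(f)$ is the ideal of $R$ obtained by glueing the ideals $I_s(f)\subseteq R_r$ of the image of $f$ in the $R_r$. Differential operators $\delta:R\to R$ of order $\le n$ are defined inductively: those of order $0$ are the multiplications $\tilde r$ by elements $r\in R$; those of order $\le n$ are the additive maps $\delta$ with $\delta\circ\tilde r-\tilde r\circ\delta$ of order $\le n-1$ for all $r\in R$. They form the ring $D_R$; for $R$ $F$-finite, $D_R=\bigcup_s \operatorname{End}_{R^{p^s}}(R)$. Modules over $D_R$ are left modules. $R_f$ carries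 the unique $D_R$-module structure for which the localization map $R\to R_f$ is $D_R$-linear. *)

(* Defs.v *)
From HB Require Import structures.
From mathcomp Require Import all_boot all_algebra.
From mathcomp Require Import ring.
From mathcomp Require Import boolp classical_sets functions.

Set Implicit Arguments.
Unset Strict Implicit.
Unset Printing Implicit Defensive.

Import GRing.Theory.
Local Open Scope ring_scope.
Local Open Scope quotient_scope.
Local Open Scope classical_set_scope.

(* All rings are commutative and possibly zero ([comPzRingType]), because     *)
(* a localization of a nonzero ring may be the zero ring.                     *)

Section Ideals.
Variable A : comPzRingType.
Implicit Types (I J M P X : set A).

Definition is_ideal I : Prop :=
  [/\ I 0, forall x y, I x -> I y -> I (x + y)
    & forall a x, I x -> I (a * x)].

Definition ideal_gen X : set A := smallest is_ideal X.

Definition prime_ideal P : Prop :=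
  [/\ is_ideal P, ~ P 1 & forall x y, P (x * y) -> P x \/ P y].

Definition maximal_ideal M : Prop :=
  [/\ is_ideal M, ~ M 1
    & forall J, is_ideal J -> M `<=` J -> ~ J 1 -> J = M].

End Ideals.

Section RegularLocal.
Variable A : comPzRingType.

Definition noetherian : Prop :=
  forall I : set A, is_ideal I ->
    exists n (x : 'I_n -> A), I = ideal_gen (range x).

(* A strict chain P 0 < P 1 < ... < P n of primes: its length is n. *)
Definition has_prime_chain (n : nat) : Prop :=
  exists P : nat -> set A,
    (forall i, (i <= n)%N -> prime_ideal (P i)) /\
    (forall i, (i < n)%N -> P i `<` P i.+1).

Definition krull_dim (d : nat) : Prop :=
  has_prime_chain d /\ (forall n, has_prime_chain n -> (n <= d)%N).

Definition regular_local : Prop :=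
  noetherian /\
  exists M : set A,
    [/\ maximal_ideal M, forall J, maximal_ideal J -> J = M
      & exists d, krull_dim d /\ exists x : 'I_d -> A, M = ideal_gen (range x)].

End RegularLocal.

Section Localization.
Variables (A : comPzRingType) (S : mulrClosed A).

Definition denom := {s : A | s \in S}.
Implicit Types (x y z : A * denom) (s t : denom).

Definition mk_denom (s : A) (hs : s \in S) : denom := exist _ s hs.

Definition one_denom : denom := mk_denom (rpred1 S).
Definition mul_denom s t : denom := mk_denom (rpredM (valP s) (valP t)).

Definition loc_equiv x y : bool :=
  `[< exists2 u, u \in S & u * (x.1 * sval y.2) = u * (y.1 * sval x.2) >].

Lemma loc_equiv_refl : reflexive loc_equiv.
Proof. by move=> x; apply/asboolP; exists 1; rewrite ?rpred1. Qed.

Lemma loc_equiv_sym : symmetric loc_equiv.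
Proof.
by move=> x y; apply/asboolP/asboolP => -[u uS e]; exists u; rewrite // e.
Qed.

Lemma loc_equiv_trans : transitive loc_equiv.
Proof.
move=> [b t] [a s] [c r] /asboolP[u uS /= e1] /asboolP[v vS /= e2].
apply/asboolP; exists (u * v * sval t) => /=.
  by rewrite !rpredM //; exact: valP t.
transitivity (v * sval r * (u * (a * sval t))); first by ring.
rewrite e1; transitivity (u * sval s * (v * (b * sval r))); first by ring.
by rewrite e2; ring.
Qed.

Canonical loc_equiv_rel :=
  EquivRel loc_equiv loc_equiv_refl loc_equiv_sym loc_equiv_trans.

Definition localization := {eq_quot loc_equiv}.
HB.instance Definition _ : EqQuotient _ loc_equiv localization :=
  EqQuotient.on localization.
HB.instance Definition _ := Choice.on localization.

Definition loc_frac (a : A) (s : denom) : localization :=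
  \pi_localization (a, s).

Lemma loc_fracE (a b : A) s t :
  (exists2 u, u \in S & u * (a * sval t) = u * (b * sval s)) ->
  loc_frac a s = loc_frac b t.
Proof. by move=> e; apply/eqmodP/asboolP. Qed.

Lemma loc_frac_eq (a b : A) s t : loc_frac a s = loc_frac b t ->
  exists2 u, u \in S & u * (a * sval t) = u * (b * sval s).
Proof. by move/eqmodP/asboolP. Qed.

Lemma loc_fracW (P : localization -> Prop) :
  (forall a s, P (loc_frac a s)) -> forall w, P w.
Proof. by move=> H; elim/quotW => -[a s]; apply: H. Qed.

Lemma loc_frac_repr (w : localization) : loc_frac (repr w).1 (repr w).2 = w.
Proof. by rewrite /loc_frac -surjective_pairing reprK. Qed.

Definition loc_add (w w' : localization) : localization :=
  loc_frac ((repr w).1 * sval (repr w').2 + (repr w').1 * sval (repr w).2)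
       (mul_denom (repr w).2 (repr w').2).
Definition loc_opp (w : localization) : localization :=
  loc_frac (- (repr w).1) (repr w).2.
Definition loc_mul (w w' : localization) : localization :=
  loc_frac ((repr w).1 * (repr w').1) (mul_denom (repr w).2 (repr w').2).
Definition loc_zero : localization := loc_frac 0 one_denom.
Definition loc_one : localization := loc_frac 1 one_denom.

Lemma loc_addE a b s t :
  loc_add (loc_frac a s) (loc_frac b t) =
  loc_frac (a * sval t + b * sval s) (mul_denom s t).
Proof.
have [u uS e1] := loc_frac_eq (loc_frac_repr (loc_frac a s)).
have [v vS e2] := loc_frac_eq (loc_frac_repr (loc_frac b t)).
rewrite /loc_add; move: (repr _) (repr _) e1 e2 => [b' t'] [a' s'] /= e1 e2.
apply: loc_fracE; exists (u * v); rewrite ?rpredM //=.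
transitivity (v * sval t * sval t' * (u * (a' * sval s))
            + u * sval s * sval s' * (v * (b' * sval t))); first by ring.
by rewrite e1 e2; ring.
Qed.

Lemma loc_oppE a s : loc_opp (loc_frac a s) = loc_frac (- a) s.
Proof.
have [u uS e1] := loc_frac_eq (loc_frac_repr (loc_frac a s)).
rewrite /loc_opp; move: (repr _) e1 => [a' s'] /= e1.
by apply: loc_fracE; exists u; rewrite //= !mulNr !mulrN e1.
Qed.

Lemma loc_mulE a b s t :
  loc_mul (loc_frac a s) (loc_frac b t) = loc_frac (a * b) (mul_denom s t).
Proof.
have [u uS e1] := loc_frac_eq (loc_frac_repr (loc_frac a s)).
have [v vS e2] := loc_frac_eq (loc_frac_repr (loc_frac b t)).
rewrite /loc_mul; move: (repr _) (repr _) e1 e2 => [b' t'] [a' s'] /= e1 e2.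
apply: loc_fracE; exists (u * v); rewrite ?rpredM //=.
transitivity ((u * (a' * sval s)) * (v * (b' * sval t))); first by ring.
by rewrite e1 e2; ring.
Qed.

Lemma loc_frac_eq1 (a b : A) s t :
  a * sval t = b * sval s -> loc_frac a s = loc_frac b t.
Proof. by move=> e; apply: loc_fracE; exists 1; rewrite ?rpred1 // e. Qed.

Fact loc_addA : associative loc_add.
Proof.
elim/loc_fracW=> a s; elim/loc_fracW=> b t; elim/loc_fracW=> c r.
rewrite !loc_addE.
by apply: loc_frac_eq1 => /=; ring.
Qed.

Fact loc_addC : commutative loc_add.
Proof.
elim/loc_fracW=> a s; elim/loc_fracW=> b t; rewrite !loc_addE.
by apply: loc_frac_eq1 => /=; ring.
Qed.

Fact loc_add0 : left_id loc_zero loc_add.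
Proof.
by elim/loc_fracW=> a s; rewrite loc_addE; apply: loc_frac_eq1 => /=; ring.
Qed.

Fact loc_addN : left_inverse loc_zero loc_opp loc_add.
Proof.
by elim/loc_fracW=> a s; rewrite loc_oppE loc_addE;
  apply: loc_frac_eq1 => /=; ring.
Qed.

HB.instance Definition _ :=
  GRing.isZmodule.Build localization loc_addA loc_addC loc_add0 loc_addN.

Fact loc_mulA : associative loc_mul.
Proof.
elim/loc_fracW=> a s; elim/loc_fracW=> b t; elim/loc_fracW=> c r.
rewrite !loc_mulE.
by apply: loc_frac_eq1 => /=; ring.
Qed.

Fact loc_mulC : commutative loc_mul.
Proof.
elim/loc_fracW=> a s; elim/loc_fracW=> b t; rewrite !loc_mulE.
by apply: loc_frac_eq1 => /=; ring.
Qed.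

Fact loc_mul1 : left_id loc_one loc_mul.
Proof.
by elim/loc_fracW=> a s; rewrite loc_mulE; apply: loc_frac_eq1 => /=; ring.
Qed.

Fact loc_mulDl : left_distributive loc_mul loc_add.
Proof.
elim/loc_fracW=> a s; elim/loc_fracW=> b t; elim/loc_fracW=> c r.
by rewrite !(loc_mulE, loc_addE); apply: loc_frac_eq1 => /=; ring.
Qed.

HB.instance Definition _ :=
  GRing.Zmodule_isComPzRing.Build localization
    loc_mulA loc_mulC loc_mul1 loc_mulDl.

Definition toloc (a : A) : localization := loc_frac a one_denom.

End Localization.

Section LocalizationAt.
Variable A : comPzRingType.

Definition powers (f : A) : {pred A} :=
  fun x => `[< exists n, x = f ^+ n >].

Fact powers_closed (f : A) : mulr_closed (powers f).
Proof.
split; first by apply/asboolP; exists 0%N.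
by move=> _ _ /asboolP[m ->] /asboolP[n ->]; apply/asboolP; exists (m + n)%N;
  rewrite exprD.
Qed.

HB.instance Definition _ f :=
  GRing.isMulClosed.Build A (powers f) (powers_closed f).

Fact mem_powers (f : A) : f \in powers f.
Proof. by apply/asboolP; exists 1%N. Qed.

Definition prime_compl (P : set A) (hP : prime_ideal P) : {pred A} :=
  fun x => `[< ~ P x >].

Fact prime_compl_closed (P : set A) (hP : prime_ideal P) :
  mulr_closed (prime_compl hP).
Proof.
have [_ P1 PM] := hP; split; first exact/asboolP.
by move=> x y /asboolP Px /asboolP Py; apply/asboolP => /PM[].
Qed.

HB.instance Definition _ P (hP : prime_ideal P) :=
  GRing.isMulClosed.Build A (prime_compl hP) (prime_compl_closed hP).

Definition loc_elt (f : A) : comPzRingType := localization (powers f).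

Definition loc_prime (P : set A) (hP : prime_ideal P) : comPzRingType :=
  localization (prime_compl hP).

Definition to_loc_elt (f : A) : A -> loc_elt f := toloc (powers f).

Definition loc_inv (f : A) : loc_elt f :=
  loc_frac 1 (mk_denom (mem_powers f)).

Definition regular_ring : Prop :=
  noetherian A /\
  forall (P : set A) (hP : prime_ideal P), regular_local (loc_prime hP).

End LocalizationAt.

Section FrobeniusIdeals.
Variable A : comPzRingType.

(* In this section q is a power of the characteristic, so that the q-th       *)
(* powers form the subring A^q of A. The family [a] expresses [x] as a linear *)
(* combination of the family [b] with coefficients in A^q.                    *)
Definition pow_coords (q n : nat) (b : 'I_n -> A) (x : A)
    (a : {ffun 'I_n -> A}) : Prop :=
  (forall i, exists c, a i = c ^+ q) /\ x = \sum_(i < n) a i * b i.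

Definition F_finite (p : nat) : Prop :=
  exists n (b : 'I_n -> A), forall x, exists a, pow_coords p b x a.

(* Over an F-finite ring only finite bases occur (up to the zero ring, where  *)
(* every basis yields the same ideal).                                        *)
Definition is_pow_basis (q n : nat) (b : 'I_n -> A) : Prop :=
  forall x, exists! a, pow_coords q b x a.

(* The ideal generated by the c_i, where the c_i ^+ q are the coordinates of  *)
(* x in the basis b. *)
Definition root_ideal (q n : nat) (b : 'I_n -> A) (x : A) : set A :=
  ideal_gen [set c | exists a, pow_coords q b x a /\ exists i, a i = c ^+ q].

End FrobeniusIdeals.

(* The glued ideal is the set of global sections of the ideal sheaf, i.e. of  *)
(* the elements whose image in A_r lies in the ideal computed there, for      *)
(* every basic open Spec A_r on which A_r is free over the subring of its     *)
(* p^s-th powers. When A is regular and F-finite these opens cover Spec A, and*)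
(* the local ideal does not depend on the basis.                              *)
Definition I_ (A : comPzRingType) (p s : nat) (f : A) : set A :=
  [set x | forall (r : A) (n : nat) (b : 'I_n -> loc_elt r),
     is_pow_basis (p ^ s) b ->
     root_ideal (p ^ s) b (to_loc_elt r f) (to_loc_elt r x)].

Section DifferentialOperators.
Variable R : comPzRingType.

Fixpoint diffop_le (n : nat) (d : R -> R) : Prop :=
  if n is m.+1 then
    (forall x y, d (x + y) = d x + d y) /\
    (forall r, diffop_le m (fun x => d (r * x) - r * d x))
  else exists r, d = (fun x => r * x).

Definition diffop_pred : {pred R -> R} :=
  fun d => `[< exists n, diffop_le n d >].

Lemma diffop_le_add n d : diffop_le n d -> {morph d : x y / x + y}.
Proof. by case: n => [[r ->] x y|n []//]; rewrite mulrDr. Qed.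

Lemma diffop_leS n d : diffop_le n d -> diffop_le n.+1 d.
Proof.
elim: n d => [|n IHn] d dn; (split; first exact: diffop_le_add dn).
  case: dn => s -> r; exists 0; apply/funext => x.
  by rewrite mul0r mulrCA subrr.
by move=> r; apply: IHn; have [_] := dn; apply.
Qed.

Lemma diffop_le_leq m n d : (m <= n)%N -> diffop_le m d -> diffop_le n d.
Proof.
move=> /subnK <-; elim: (n - m)%N => // k IHk dm.
by rewrite addSn; apply/diffop_leS/IHk.
Qed.

Lemma diffop_leD n d e : diffop_le n d -> diffop_le n e ->
  diffop_le n (fun x => d x + e x).
Proof.
elim: n d e => [|n IHn] d e.
  by move=> [r ->] [s ->]; exists (r + s); apply/funext => x; rewrite mulrDl.
move=> [dD dn] [eD en]; split=> [x y|r]; first by rewrite dD eD addrACA.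
under eq_fun do rewrite mulrDr opprD addrACA.
exact: (IHn _ _ (dn r) (en r)).
Qed.

Lemma diffop_leN n d : diffop_le n d -> diffop_le n (fun x => - d x).
Proof.
elim: n d => [|n IHn] d.
  by move=> [r ->]; exists (- r); apply/funext => x; rewrite mulNr.
move=> [dD dn]; split=> [x y|r]; first by rewrite dD opprD.
under eq_fun do rewrite mulrN -opprD.
exact: (IHn _ (dn r)).
Qed.

Lemma diffop_le_mull n d r : diffop_le n d -> diffop_le n (fun x => r * d x).
Proof.
elim: n d => [|n IHn] d.
  by move=> [s ->]; exists (r * s); apply/funext => x; rewrite mulrA.
move=> [dD dn]; split=> [x y|s]; first by rewrite dD mulrDr.
under eq_fun do rewrite mulrCA -mulrBr.
exact: (IHn _ (dn s)).
Qed.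

Lemma diffop_le_mulr n d r : diffop_le n d -> diffop_le n (fun x => d (r * x)).
Proof.
elim: n d => [|n IHn] d.
  by move=> [s ->]; exists (s * r); apply/funext => x; rewrite mulrA.
move=> [dD dn]; split=> [x y|s]; first by rewrite mulrDr dD.
under eq_fun do rewrite mulrCA.
exact: (IHn _ (dn s)).
Qed.

Lemma diffop_le_comp m n d e : diffop_le m d -> diffop_le n e ->
  diffop_le (m + n) (d \o e).
Proof.
elim: m n d e => [|m IHm] n d e; first by move=> [r ->]; apply: diffop_le_mull.
elim: n e => [|n IHn] e dm.
  by move=> [r ->]; rewrite addn0; apply: diffop_le_mulr.
move=> en; have dD := diffop_le_add dm; have eD := diffop_le_add en.
have dB x y : d (x - y) = d x - d y.
  by apply: (addIr (d y)); rewrite -dD !subrK.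
rewrite addSn; split=> [x y /=|r]; first by rewrite eD dD.
rewrite (_ : (fun x => _) = (fun x => d (e (r * x) - r * e x)
                                    + (d (r * e x) - r * d (e x)))); last first.
  by apply/funext => x /=; rewrite dB addrA subrK.
apply: diffop_leD.
  by rewrite addnS -addSn; apply: (IHn _ dm); have [_] := en; apply.
by have [_ /(_ r) dr] := dm; exact: (IHm _ _ e dr en).
Qed.

Fact diffop_zmod_closed : zmod_closed diffop_pred.
Proof.
split.
  by apply/asboolP; exists 0%N, 0; apply/funext => x; rewrite mul0r.
move=> d e /asboolP[m dm] /asboolP[n en]; apply/asboolP; exists (maxn m n).
apply: (diffop_leD (diffop_le_leq (leq_maxl m n) dm)).
exact: (diffop_leN (diffop_le_leq (leq_maxr m n) en)).
Qed.

HB.instance Definition _ :=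
  GRing.isZmodClosed.Build (R -> R) diffop_pred diffop_zmod_closed.

(* The ring D_R, with composition as product *)
Record diffop := DiffOp {
  diffop_fun :> R -> R;
  diffopP : diffop_fun \in diffop_pred }.

HB.instance Definition _ := [isSub for diffop_fun].
HB.instance Definition _ := [Choice of diffop by <:].
HB.instance Definition _ := [SubChoice_isSubZmodule of diffop by <:].

Implicit Types d e : diffop.

Lemma diffop_eq d e : (forall x, d x = e x) -> d = e.
Proof. by move=> de; apply/val_inj/funext. Qed.

Fact diffop_mul_proof d e : (d \o e : R -> R) \in diffop_pred.
Proof.
case: d e => d /= /asboolP[m dm] [e /= /asboolP[n en]].
by apply/asboolP; exists (m + n)%N; apply: diffop_le_comp.
Qed.

Definition diffop_mul d e : diffop := DiffOp (diffop_mul_proof d e).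

Fact mulop_proof (r : R) : (fun x => r * x) \in diffop_pred.
Proof. by apply/asboolP; exists 0%N, r. Qed.

Definition mulop (r : R) : diffop := DiffOp (mulop_proof r).

Lemma diffopD d : {morph d : x y / x + y}.
Proof. by case: d => d /= /asboolP[n /diffop_le_add]. Qed.

Fact diffop_mulA : associative diffop_mul.
Proof. by move=> d e c; apply: diffop_eq. Qed.
Fact diffop_mul1l : left_id (mulop 1) diffop_mul.
Proof. by move=> d; apply: diffop_eq => x /=; rewrite mul1r. Qed.
Fact diffop_mul1r : right_id (mulop 1) diffop_mul.
Proof. by move=> d; apply: diffop_eq => x /=; rewrite mul1r. Qed.
Fact diffop_mulDl : left_distributive diffop_mul +%R.
Proof. by move=> d e c; apply: diffop_eq. Qed.
Fact diffop_mulDr : right_distributive diffop_mul +%R.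
Proof. by move=> d e c; apply: diffop_eq => x /=; apply: diffopD. Qed.

HB.instance Definition _ := GRing.Zmodule_isPzRing.Build diffop
  diffop_mulA diffop_mul1l diffop_mul1r diffop_mulDl diffop_mulDr.

End DifferentialOperators.

(* [act] is a left D-module structure on the abelian group V. *)
Record is_left_module (D : pzRingType) (V : zmodType) (act : D -> V -> V) :
    Prop := IsLeftModule {
  act_mul : forall a b v, act (a * b) v = act a (act b v);
  act_one : forall v, act 1 v = v;
  act_addr : forall a, {morph act a : u v / u + v};
  act_addl : forall v, {morph act^~ v : a b / a + b} }.

(* [act] is the D_R-module structure of R_f: it extends the R-module          *)
(* structure of R_f and makes the localization map R -> R_f D_R-linear.       *)
(* (D_R-linearity alone would not determine it, since an arbitrary additive   *)
(* action of R on R_f would be allowed.)                                      *)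
Record is_loc_dmodule (R : comPzRingType) (f : R)
    (act : diffop R -> loc_elt f -> loc_elt f) : Prop := IsLocDModule {
  loc_act_module : is_left_module act;
  loc_act_mulop : forall r m, act (mulop r) m = to_loc_elt f r * m;
  loc_act_linear : forall d x, act d (to_loc_elt f x) = to_loc_elt f (d x) }.

(* Main.v *)
(* In a regular local ring A of dimension d with maximal ideal (x_1, ..., x_d),   *)
(* Krull's principal ideal theorem lets one reroute a chain of primes of length d  *)
(* so that its k-th prime contains x_1, ..., x_k; by Nakayama it is then generated *)
(* by them. Hence the x_i form a sequence of prime elements modulo each other, in  *)
(* any order, their q-th powers form a regular sequence, and a minimal family of   *)
(* generators of A over A^q is a basis. Around each prime of R this yields         *)
(* elements b_i and q^-1-linear maps phi_i : R -> R with                           *)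
(* r^q x = sum_i phi_i(x)^q b_i and phi_i(b_j) = r delta_ij.                       *)
(*                                                                                 *)
(* It follows, with q = p^s, that I_s(g) is the ideal of all phi(g), phi a         *)
(* q^-1-linear endomorphism of R, that h lies in End_{R^q}(R) g if and only if     *)
(* I_s(h) is contained in I_s(g), and that I_{s+k}(g^{p^k}) = I_s(g). Since R is   *)
(* F-finite, D_R is the union of the End_{R^q}(R). Multiplying 1/f^p = delta(1/f)  *)
(* by f^{p^s} turns it into f^{p^s-p} = delta(f^{p^s-1}), which is solvable in     *)
(* End_{R^{p^s}}(R) exactly when I_{s-1}(f^{p^{s-1}-1}) = I_s(f^{p^s-1}).          *)

Require Import Defs.
From mathcomp Require Import all_boot all_algebra.
From mathcomp Require Import ring.
From mathcomp Require Import boolp classical_sets.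

Set Implicit Arguments.
Unset Strict Implicit.
Unset Printing Implicit Defensive.

Import GRing.Theory.
Local Open Scope ring_scope.
Local Open Scope classical_set_scope.

(** * Ideals, saturation and Nakayama's lemma *)

Section Ideals.
Variable A : comPzRingType.
Implicit Types (I J M N K P Q T : set A) (s : seq A).

Lemma ideal0 I : is_ideal I -> I 0. Proof. by case. Qed.

Lemma idealD I x y : is_ideal I -> I x -> I y -> I (x + y).
Proof. by case=> _ + _; apply. Qed.

Lemma ideal_mull I a x : is_ideal I -> I x -> I (a * x).
Proof. by case=> _ _; apply. Qed.

Lemma ideal_mulr I a x : is_ideal I -> I x -> I (x * a).
Proof. by rewrite mulrC; apply: ideal_mull. Qed.

Lemma idealN I x : is_ideal I -> I x -> I (- x).
Proof. by rewrite -mulN1r; apply: ideal_mull. Qed.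

Lemma idealB I x y : is_ideal I -> I x -> I y -> I (x - y).
Proof. by move=> hI Ix Iy; apply: idealD => //; apply: idealN. Qed.

Lemma idealDr I x y : is_ideal I -> I x -> I (x + y) -> I y.
Proof. by move=> hI Ix Ixy; rewrite -(addKr x y) addrC; apply: idealB. Qed.

Lemma ideal1 I a : is_ideal I -> I 1 -> I a.
Proof. by move=> hI I1; rewrite -(mulr1 a); apply: ideal_mull. Qed.

Lemma ideal_sum (J : Type) (r : seq J) (Pr : pred J) (F : J -> A) I :
  is_ideal I -> (forall i, I (F i)) -> I (\sum_(i <- r | Pr i) F i).
Proof.
move=> hI IF; apply: big_ind => //; first exact: ideal0.
by move=> x y; apply: idealD.
Qed.

Lemma prime_isideal P : prime_ideal P -> is_ideal P. Proof. by case. Qed.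

Lemma primeM P x y : prime_ideal P -> ~ P x -> ~ P y -> ~ P (x * y).
Proof. by case=> _ _ hP Px Py /hP[]. Qed.

Lemma primeX P x n : prime_ideal P -> ~ P x -> ~ P (x ^+ n).
Proof.
move=> hP Px; elim: n => [|n IH]; first by rewrite expr0; case: hP.
by rewrite exprS; apply: primeM.
Qed.

Lemma prime_ideal_mul P x y : prime_ideal P -> P (x * y) -> ~ P x -> P y.
Proof. by case=> _ _ hP /hP[]. Qed.

Lemma ideal_gen_ideal (X : set A) : is_ideal (ideal_gen X).
Proof.
split=> [I [[] //]|x y Xx Xy I hI|a x Xx I hI].
  by apply: idealD; [case: hI|apply: Xx|apply: Xy].
by apply: ideal_mull; [case: hI|apply: Xx].
Qed.

Lemma sub_ideal_gen (X : set A) : X `<=` ideal_gen X.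
Proof. exact: sub_smallest. Qed.

Lemma ideal_gen_sub (X : set A) I : is_ideal I -> X `<=` I -> ideal_gen X `<=` I.
Proof. exact: smallest_sub. Qed.

Definition adjoin I x : set A := [set z | exists2 a, I a & exists c, z = a + c * x].

Lemma adjoin_ideal I x : is_ideal I -> is_ideal (adjoin I x).
Proof.
move=> hI; split.
- by exists 0; [exact: ideal0|exists 0; rewrite mul0r addr0].
- move=> _ _ [a Ia [c ->]] [b Ib [d ->]]; exists (a + b); first exact: idealD.
  by exists (c + d); rewrite mulrDl addrACA.
- move=> e _ [a Ia [c ->]]; exists (e * a); first exact: ideal_mull.
  by exists (e * c); rewrite mulrDr mulrA.
Qed.

Lemma sub_adjoin I x : I `<=` adjoin I x.
Proof. by move=> a Ia; exists a => //; exists 0; rewrite mul0r addr0. Qed.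

Lemma mem_adjoin I x : is_ideal I -> adjoin I x x.
Proof. by move=> hI; exists 0; [exact: ideal0|exists 1; rewrite mul1r add0r]. Qed.

Lemma adjoin_sub I J x : is_ideal J -> I `<=` J -> J x -> adjoin I x `<=` J.
Proof.
by move=> hJ IJ Jx _ [a Ia [c ->]]; apply: idealD => //; [exact: IJ|exact: ideal_mull].
Qed.

Fixpoint lspan s : set A := if s is x :: t then adjoin (lspan t) x else [set 0].

Lemma lspan_ideal s : is_ideal (lspan s).
Proof.
elim: s => [|x s IH]; last exact: adjoin_ideal.
by split=> [//|x y -> ->|a x ->] /=; rewrite ?addr0 ?mulr0.
Qed.
Hint Resolve lspan_ideal : core.

Lemma mem_lspan s x : x \in s -> lspan s x.
Proof.
elim: s => //= y s IH; rewrite inE => /orP[/eqP -> |/IH sx].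
  exact: mem_adjoin.
exact: sub_adjoin.
Qed.

Lemma lspan_sub I s : is_ideal I -> (forall x, x \in s -> I x) -> lspan s `<=` I.
Proof.
move=> hI; elim: s => [|y s IH] sI /=; first by move=> _ ->; exact: ideal0.
apply: adjoin_sub => //; last by apply: sI; rewrite mem_head.
by apply: IH => x xs; apply: sI; rewrite inE xs orbT.
Qed.

Lemma lspan_mono s t : {subset s <= t} -> lspan s `<=` lspan t.
Proof. by move=> st; apply: lspan_sub => // x /st; apply: mem_lspan. Qed.

Lemma lspan_eqi s t : s =i t -> lspan s = lspan t.
Proof. by move=> st; apply/seteqP; split; apply: lspan_mono => x; rewrite st. Qed.

Lemma ideal_gen_range (n : nat) (x : 'I_n -> A) : ideal_gen (range x) = lspan (codom x).
Proof.
apply/seteqP; split.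
  by apply: ideal_gen_sub => // _ [i _ <-]; apply/mem_lspan/codom_f.
apply: lspan_sub; first exact: ideal_gen_ideal.
by move=> _ /codomP[i ->]; apply: sub_ideal_gen; exists i.
Qed.

Definition sat P I : set A := [set a | exists2 t, ~ P t & I (t * a)].

Lemma sat_ideal P I : prime_ideal P -> is_ideal I -> is_ideal (sat P I).
Proof.
move=> hP hI; split.
- by exists 1; [case: hP|rewrite mulr0; exact: ideal0].
- move=> x y [t Pt tx] [u Pu uy]; exists (t * u); first exact: primeM.
  have -> : t * u * (x + y) = u * (t * x) + t * (u * y) by ring.
  by apply: idealD => //; apply: ideal_mull.
- move=> a x [t Pt tx]; exists t => //.
  by rewrite mulrCA; apply: ideal_mull.
Qed.

Lemma sub_sat P I : prime_ideal P -> I `<=` sat P I.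
Proof. by move=> [_ P1 _] x Ix; exists 1; rewrite ?mul1r. Qed.

Lemma sat_sat P Q I t a : prime_ideal Q -> Q `<=` P -> ~ P t ->
  sat Q I (t * a) -> sat Q I a.
Proof.
move=> hQ QP Pt [u Qu uta]; exists (u * t); last by rewrite -mulrA.
by apply: primeM => // /QP.
Qed.

Lemma sat_mono P I J : I `<=` J -> sat P I `<=` sat P J.
Proof. by move=> IJ a [t Pt ta]; exists t => //; apply: IJ. Qed.

Lemma nakayama P I x s : prime_ideal P -> P x -> is_ideal I ->
  (forall y, y \in s -> exists2 t, ~ P t &
     exists2 z, I z & exists2 w, lspan s w & t * y = z + x * w) ->
  lspan s `<=` sat P I.
Proof.
move=> hP Px hI; have hS := sat_ideal hP hI.
elim: s => [|m s IH] Hs /=; first by move=> _ ->; apply: ideal0.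
have [t Pt [z Iz [_ [w sw [c ->]] e]]] := Hs m (mem_head _ _).
have Pt0 : ~ P (t - x * c).
  by move=> H; apply: Pt; rewrite -(subrK (x * c) t); apply: idealD H _;
    [case: hP|apply: ideal_mulr => //; case: hP].
have e0 : (t - x * c) * m = z + x * w.
  have -> : (t - x * c) * m = t * m - x * c * m by ring.
  by rewrite e; ring.
have sS : lspan s `<=` sat P I.
  apply: IH => y ys.
  have [|u Pu [z' Iz' [_ [w' sw' [c' ->]] e']]] := Hs y; first by rewrite inE ys orbT.
  exists ((t - x * c) * u); first exact: primeM.
  exists ((t - x * c) * z' + x * c' * z).
    by apply: idealD => //; apply: ideal_mull.
  exists ((t - x * c) * w' + c' * x * w).
    by apply: idealD => //; apply: ideal_mull.
  rewrite -mulrA e'.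
  transitivity ((t - x * c) * z' + x * (t - x * c) * w' + x * c' * ((t - x * c) * m)).
    by ring.
  by rewrite e0; ring.
apply: adjoin_sub => //.
apply: (@sat_sat P P _ (t - x * c)) => //; rewrite e0.
apply: idealD; rewrite //; first exact: sub_sat.
by apply: ideal_mull => //; apply: sS.
Qed.

Definition colon I y : set A := [set a | I (a * y)].

Lemma colon_ideal I y : is_ideal I -> is_ideal (colon I y).
Proof.
move=> hI; split; rewrite /colon /=.
- by rewrite mul0r; exact: ideal0.
- by move=> a b Ia Ib; rewrite mulrDl; apply: idealD.
- by move=> a b Ib; rewrite -mulrA; apply: ideal_mull.
Qed.

End Ideals.
#[global] Hint Resolve lspan_ideal : core.

(** * Chains of primes in Noetherian rings *)

Section Noetherian.
Variable A : comPzRingType.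
Hypothesis noethA : noetherian A.
Implicit Types (I J M N K P Q T : set A) (s : seq A).

Lemma noetherian_lspan I : is_ideal I -> exists s, I = lspan s.
Proof.
move=> /noethA[n [x ->]]; exists (codom x); exact: ideal_gen_range.
Qed.

Lemma noetherian_max (F : set (set A)) I0 : F I0 -> (forall I, F I -> is_ideal I) ->
  exists2 M, F M /\ I0 `<=` M & forall J, F J -> M `<=` J -> J `<=` M.
Proof.
move=> F0 Fi; apply: contrapT => nomax.
have nxt (I : {I : set A | F I /\ I0 `<=` I}) : exists J : {I : set A | F I /\ I0 `<=` I},
    sval I `<=` sval J /\ ~ (sval J `<=` sval I).
  case: I => I [FI I0I] /=; apply: contrapT => H; apply: nomax; exists I => // J FJ IJ.
  apply: contrapT => JI; apply: H.
  by exists (exist _ J (conj FJ (subset_trans I0I IJ))).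
have [g gP] := choice nxt.
pose C n := iter n g (exist _ I0 (conj F0 (@subset_refl _ I0))).
have CS n : sval (C n) `<=` sval (C n.+1) by have [] := gP (C n).
have Cm m n : (m <= n)%N -> sval (C m) `<=` sval (C n).
  by move=> /subnK <-; elim: (n - m)%N => // k IH; apply: subset_trans IH (CS _).
have Ci n : is_ideal (sval (C n)) by apply: Fi; have [] := svalP (C n).
pose U : set A := [set x | exists n, sval (C n) x].
have hU : is_ideal U.
  split; first by exists 0%N; exact: ideal0.
    move=> x y [m Cx] [n Cy]; exists (maxn m n); apply: idealD => //.
      exact: Cm (leq_maxl _ _) _ Cx.
    exact: Cm (leq_maxr _ _) _ Cy.
  by move=> a x [n Cx]; exists n; apply: ideal_mull.
have [s Us] := noetherian_lspan hU.
have [n sn] : exists n, forall x, x \in s -> sval (C n) x.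
  have: forall x, x \in s -> U x by move=> x xs; rewrite Us; apply: mem_lspan.
  elim: {Us} s => [|y s IH] sU; first by exists 0%N.
  have [n Hn] : exists n, forall x, x \in s -> sval (C n) x.
    by apply: IH => x xs; apply: sU; rewrite inE xs orbT.
  have [m Hm] := sU y (mem_head _ _).
  exists (maxn m n) => x; rewrite inE => /orP[/eqP ->|/Hn].
    exact: Cm (leq_maxl _ _) _ Hm.
  exact: Cm (leq_maxr _ _) _.
have [_] := gP (C n); apply => x Cx.
by apply: (lspan_sub (Ci n) sn); rewrite -Us; exists n.+1.
Qed.

Lemma nakayama_ideal P I M x : prime_ideal P -> P x -> is_ideal I -> is_ideal M ->
  (forall y, M y -> exists2 t, ~ P t &
     exists2 z, I z & exists2 w, M w & t * y = z + x * w) ->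
  M `<=` sat P I.
Proof.
move=> hP Px hI /noetherian_lspan[s ->] H.
by apply: nakayama Px hI _ => // y /mem_lspan; apply: H.
Qed.

(* [colon N y] is prime when it is maximal among the proper ideals of this form. *)
Lemma exists_prime_colon N : is_ideal N -> ~ N 1 ->
  exists2 y, ~ N y & prime_ideal (colon N y).
Proof.
move=> hN N1.
pose F : set (set A) := [set J | exists2 y, ~ N y & J = colon N y].
have F1 : F (colon N 1) by exists 1.
have Fi J : F J -> is_ideal J by move=> [y _ ->]; exact: colon_ideal.
have [_ [[y Ny ->] _] ymax] := noetherian_max F1 Fi.
exists y => //; split; first exact: colon_ideal.
  by rewrite /colon /= mul1r.
move=> a b Nab; rewrite orC; apply: contrapT => /not_orP[nb na].
apply: na; apply: (ymax (colon N (b * y))).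
- by exists (b * y).
- by move=> c; rewrite /colon /= mulrCA; apply: ideal_mull.
- by rewrite /colon /= mulrA.
Qed.

Lemma proper_sub_maximal I : is_ideal I -> ~ I 1 ->
  exists2 M, maximal_ideal M & I `<=` M.
Proof.
move=> hI I1.
have [M [[hM M1] IM] Mmax] := @noetherian_max [set J | is_ideal J /\ ~ J 1] I
  (conj hI I1) (fun J hJ => proj1 hJ).
exists M => //; split=> // J hJ MJ J1.
by apply/seteqP; split=> //; apply: Mmax.
Qed.

Lemma proper_sub_prime I : is_ideal I -> ~ I 1 -> exists2 P, prime_ideal P & I `<=` P.
Proof.
move=> hI /(exists_prime_colon hI)[y Iy hP]; exists (colon I y) => // a Ia.
exact: ideal_mulr.
Qed.

Definition saturated P I := forall t a, ~ P t -> I (t * a) -> I a.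

(* Chain condition of the Artinian ring [A_P / K A_P]. *)
Lemma saturated_dcc P K (J : nat -> set A) : prime_ideal P ->
  (forall P', prime_ideal P' -> K `<=` P' -> P' `<=` P -> P `<=` P') ->
  (forall n, is_ideal (J n)) -> (forall n, saturated P (J n)) ->
  (forall n, K `<=` J n) -> (forall n, J n.+1 `<=` J n) ->
  exists n0, forall n, (n0 <= n)%N -> J n `<=` J n.+1.
Proof.
move=> hP Pmin; have iP := prime_isideal hP.
pose chain N (L : nat -> set A) := [/\ forall n, is_ideal (L n),
  forall n, saturated P (L n), forall n, N `<=` L n & forall n, L n.+1 `<=` L n].
pose stable (L : nat -> set A) := exists n0, forall n, (n0 <= n)%N -> L n `<=` L n.+1.
move=> Ji Js KJ Jd; change (stable J); apply: contrapT => Jbad.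
pose F : set (set A) := [set N | [/\ is_ideal N, saturated P N, K `<=` N
  & exists2 L, chain N L & ~ stable L]].
have [N0 [F0 Fi]] : exists N, F N /\ forall I, F I -> is_ideal I.
  pose N : set A := [set a | forall n, J n a].
  exists N; split; last by move=> I [].
  split; last by exists J => //; split=> // n a Na; exact: Na.
  - split; first by move=> n; exact: ideal0.
      by move=> x y Nx Ny n; apply: idealD; [exact: Ji|exact: Nx|exact: Ny].
    by move=> a x Nx n; apply: ideal_mull; [exact: Ji|exact: Nx].
  - by move=> t a Pt Nta n; apply: Js Pt (Nta n).
  - by move=> a Ka n; apply: KJ.
(* Noetherian induction: [N] is maximal among the bases of bad chains. *)
have [N [[hN sN KN [L [Li Ls NL Ld] Lbad]] _] Nmax] := noetherian_max F0 Fi.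
have N1 : ~ N 1.
  by move=> N1; apply: Lbad; exists 0%N => n _ a _; apply: (NL n.+1); exact: ideal1.
have [y Ny hPy] := exists_prime_colon hN N1.
have Py : P `<=` colon N y.
  apply: Pmin => //; first by move=> a /KN Na; apply: ideal_mulr.
  by move=> a Nay; apply: contrapT => Pa; apply: Ny; apply: sN Pa Nay.
pose N' := sat P (adjoin N y); pose L' n := sat P (adjoin (L n) y).
have NN' : N `<=` N'.
  by move=> a Na; apply: sub_sat => //; apply: sub_adjoin.
have [n0 Hn0] : stable L'.
  apply: contrapT => L'bad.
  suff FN' : F N'.
    by apply: Ny; apply: (Nmax _ FN' NN'); apply: sub_sat => //; apply: mem_adjoin.
  split.
  - by apply: sat_ideal => //; apply: adjoin_ideal.
  - by move=> t a Pt; apply: sat_sat Pt.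
  - exact: subset_trans NN'.
  - exists L' => //; split=> n.
    + by apply: sat_ideal => //; apply: adjoin_ideal.
    + by move=> t a Pt; apply: sat_sat Pt.
    + apply: sat_mono; apply: adjoin_sub; first exact: adjoin_ideal.
        by apply: subset_trans (NL n) _; exact: sub_adjoin.
      exact: mem_adjoin.
    + apply: sat_mono; apply: adjoin_sub; first exact: adjoin_ideal.
        by apply: subset_trans (Ld n) _; exact: sub_adjoin.
      exact: mem_adjoin.
apply: Lbad.
have [[n1 Hn1]|Hy] := pselect (exists n, ~ L n y).
  exists (maxn n0 n1) => n; rewrite geq_max => /andP[n0n n1n] a La.
  have Lny : ~ L n y.
    move=> Lny; apply: Hn1; move: n1n Lny => /subnK <-.
    by elim: (n - n1)%N => // k IH /Ld.
  have : L' n.+1 a by apply: Hn0 => //; apply: sub_sat => //; apply: sub_adjoin.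
  move=> [t Pt [b Lb [c e]]].
  have Lcy : L n (c * y).
    apply: (idealDr (Li n) (Ld _ _ Lb)); rewrite -e.
    by apply: ideal_mull.
  have Pc : P c by apply: contrapT => /(Ls n _ y)/(_ Lcy).
  apply: (Ls n.+1 _ _ Pt); rewrite e; apply: idealD => //.
  by apply: (NL n.+1); exact: Py.
have {}Hy n : L n y by apply: contrapT => Lny; apply: Hy; exists n.
exists n0 => n n0n a La.
have : L' n.+1 a by apply: Hn0 => //; apply: sub_sat => //; apply: sub_adjoin.
move=> [t Pt [b Lb [c e]]].
by apply: (Ls n.+1 _ _ Pt); rewrite e; apply: idealD => //; apply: ideal_mull.
Qed.

Lemma principal_ideal_thm P0 Q P x : prime_ideal P0 -> prime_ideal Q -> prime_ideal P ->
  P0 `<` Q -> Q `<=` P -> P x -> ~ Q x ->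
  (forall P', prime_ideal P' -> adjoin P0 x `<=` P' -> P' `<=` P -> P `<=` P') -> False.
Proof.
move=> hP0 hQ hP [P0Q nQP0] QP Px Qx Pmin.
have [iP0 iQ iP] := And3 (prime_isideal hP0) (prime_isideal hQ) (prime_isideal hP).
have [q Qq P0q] : exists2 q, Q q & ~ P0 q.
  by apply: contrapT => H; apply: nQP0 => a Qa; apply: contrapT => ?; apply: H; exists a.
(* The powers of a single [q] can replace the symbolic powers of [Q]. *)
pose Qn n := sat Q (adjoin P0 (q ^+ n)).
have Qi n : is_ideal (Qn n) by apply: sat_ideal => //; apply: adjoin_ideal.
have Qd n : Qn n.+1 `<=` Qn n.
  apply: sat_mono; apply: adjoin_sub; first exact: adjoin_ideal.
    exact: sub_adjoin.
  by rewrite exprS; apply: ideal_mull; [exact: adjoin_ideal|exact: mem_adjoin].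
have P0Qn n : P0 `<=` Qn n by move=> a P0a; apply: sub_sat => //; apply: sub_adjoin.
pose J n := sat P (adjoin (Qn n) x).
have Ji n : is_ideal (J n) by apply: sat_ideal => //; apply: adjoin_ideal.
have [|||n0 /(_ n0 (leqnn _)) HJ] := @saturated_dcc P (adjoin P0 x) J hP Pmin Ji.
- by move=> n t a Pt; apply: sat_sat Pt.
- move=> n; apply: adjoin_sub => //.
    by apply: subset_trans (P0Qn n) _ => a Qa; apply: sub_sat => //; apply: sub_adjoin.
  by apply: sub_sat => //; apply: mem_adjoin.
- move=> n; apply: sat_mono; apply: adjoin_sub; first exact: adjoin_ideal.
    by apply: subset_trans (Qd n) _; exact: sub_adjoin.
  exact: mem_adjoin.
have QQ : Qn n0 `<=` Qn n0.+1.
  have sub : Qn n0 `<=` sat P (Qn n0.+1).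
    apply: (nakayama_ideal hP Px) => // a Qa.
    have /HJ[t Pt [b Qb [c e]]] : J n0 a by apply: sub_sat => //; apply: sub_adjoin.
    exists t => //; exists b => //; exists c; last by rewrite e mulrC.
    apply: (@sat_sat _ Q Q _ x) => //; rewrite mulrC.
    by apply: (idealDr (Qi n0) (Qd _ _ Qb)); rewrite -e; apply: ideal_mull.
  by move=> a /sub[t Pt]; apply: sat_sat Pt.
have /QQ[t Qt [a P0a [c e]]] : Qn n0 (q ^+ n0).
  by apply: sub_sat => //; apply: mem_adjoin.
have P0' : P0 (q ^+ n0 * (t - c * q)).
  have -> : q ^+ n0 * (t - c * q) = t * q ^+ n0 - c * q ^+ n0.+1.
    by rewrite exprS; ring.
  by rewrite e addrK.
have /P0Q Qt' := prime_ideal_mul hP0 P0' (primeX hP0 P0q).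
apply: Qt; rewrite -(subrK (c * q) t); apply: idealD => //.
exact: ideal_mull.
Qed.

Lemma prime_between P0 P1 P2 x : prime_ideal P0 -> prime_ideal P1 -> prime_ideal P2 ->
  P0 `<` P1 -> P1 `<` P2 -> P2 x ->
  exists P', [/\ prime_ideal P', P0 `<` P', P' `<` P2 & P' x].
Proof.
move=> h0 h1 h2 l01 l12 P2x; have [P1x|nP1x] := pselect (P1 x); first by exists P1.
apply: contrapT => H.
apply: (principal_ideal_thm h0 h1 h2 l01 _ P2x nP1x); first by case: l12.
move=> P' h' KP' P'P2; apply: contrapT => P2P'; apply: H; exists P'.
have i0 := prime_isideal h0.
have P'x : P' x by apply: KP'; exact: mem_adjoin.
split=> //; split.
  by apply: subset_trans KP'; exact: sub_adjoin.
by move=> /(_ _ P'x) P0x; apply: nP1x; case: l01 => + _; apply.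
Qed.

Definition prime_chain n (P : nat -> set A) :=
  (forall i, (i <= n)%N -> prime_ideal (P i)) /\
  (forall i, (i < n)%N -> P i `<` P i.+1).

Lemma prime_chain_cons n (P Q : nat -> set A) : prime_chain n.+1 P ->
  prime_chain n Q -> Q 0%N = P 1%N ->
  prime_chain n.+1 (fun i => if i is j.+1 then Q j else P 0%N).
Proof.
move=> [hP lP] [hQ lQ] e; split=> [[|i] ilt|[|i] ilt]; rewrite ?e.
- exact: hP.
- exact: hQ.
- exact: lP.
- exact: lQ.
Qed.

Lemma prime_chain_through n (P : nat -> set A) x : prime_chain n.+1 P -> P n.+1 x ->
  exists Q : nat -> set A, [/\ prime_chain n.+1 Q, Q 0%N = P 0%N, Q n.+1 = P n.+1 & Q 1%N x].
Proof.
elim: n P => [|n IH] P cP Px; first by exists P.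
have [hP lP] := cP.
have [P' [hP' l1 l2 P'x]] :=
  prime_between (hP n (leqW (leqnSn n))) (hP n.+1 (leqnSn _)) (hP n.+2 (leqnn _))
    (lP n (leqnSn _)) (lP n.+1 (leqnn _)) Px.
pose P1 i := if i == n.+1 then P' else P i.
have c1 : prime_chain n.+1 P1.
  rewrite /P1; split=> i; rewrite ?ltnS => ilt.
    by case: eqP => // _; apply: hP; rewrite (leq_trans ilt).
  rewrite eqSS ltn_eqF ?ltnS//; case: eqP => [-> //|_].
  by apply: lP; rewrite ltnS ltnW.
have P1x : P1 n.+1 x by rewrite /P1 eqxx.
have [Q [[hQ lQ] Q0 Qn Q1]] := IH P1 c1 P1x.
exists (fun i => if i == n.+2 then P n.+2 else Q i); split => //.
- split=> i; rewrite leq_eqVlt.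
    by case: eqP => [_ _|_ /= ilt]; [exact: hP|exact: hQ].
  rewrite !eqSS => /orP[/eqP ->|ilt].
    by rewrite eqxx ltn_eqF// Qn /P1 eqxx.
  by rewrite !ltn_eqF//; [exact: lQ|rewrite ltnS ltnW].
- by rewrite eqxx.
Qed.

Lemma prime_chain_through_seq s (P : nat -> set A) : prime_chain (size s) P -> 
  (forall x, x \in s -> P (size s) x) ->
  exists Q : nat -> set A, [/\ prime_chain (size s) Q, Q 0%N = P 0%N, Q (size s) = P (size s) &
    forall k, (k <= size s)%N -> forall x, x \in take k s -> Q k x].
Proof.
elim: s P => [|x s IH] P cP sP.
  by exists P; split=> // k _ x.
have [P' [cP' P'0 P'n P'x]] := prime_chain_through cP (sP x (mem_head _ _)).
have cP1 : prime_chain (size s) (fun i => P' i.+1).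
  by case: cP' => h l; split=> i ilt; [apply: h|apply: l].
have [|Q [cQ Q0 Qn Qk]] := IH _ cP1.
  by move=> y ys; rewrite P'n; apply: sP; rewrite inE ys orbT.
exists (fun i => if i is j.+1 then Q j else P' 0%N); split=> //=.
- exact: prime_chain_cons.
- by rewrite Qn.
- case=> // k klt y /=; rewrite inE => /orP[/eqP ->|]; last exact: Qk.
  have : Q 0%N x by rewrite Q0.
  move: klt; rewrite ltnS; elim: k => // k IHk klt Q0x.
  by case: cQ => _ /(_ k klt)[+ _]; apply; apply: IHk => //; exact: ltnW.
Qed.

End Noetherian.

(** * Regular local rings *)

Section RegularSequences.
Variable A : comPzRingType.
Implicit Types (T : set A) (s ys zs : seq A).

Definition regular_mod T (u : A) := forall a, T (u * a) -> T a.

Lemma regular_modX T u e : regular_mod T u -> regular_mod T (u ^+ e).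
Proof.
move=> rT; elim: e => [|e IH] a; first by rewrite expr0 mul1r.
by rewrite exprS -mulrA => /rT /IH.
Qed.

Lemma regular_mod_adjoinX T u y e : is_ideal T -> regular_mod T u ->
  regular_mod (adjoin T u) y -> regular_mod (adjoin T (u ^+ e)) y.
Proof.
move=> hT ru ry; elim: e => [|e IH] a.
  by exists 0; [exact: ideal0|exists a; rewrite expr0 mulr1 add0r].
move=> [t Tt [w e1]].
have [t' Tt' [a' ea]] : adjoin T (u ^+ e) a.
  by apply: IH; exists t => //; exists (w * u); rewrite e1 exprS mulrA.
have T1 : T (u ^+ e * (y * a' - w * u)).
  have -> : u ^+ e * (y * a' - w * u) = t - y * t'.
    transitivity (y * a - y * t' - w * u ^+ e.+1); first by rewrite ea exprS; ring.
    by rewrite e1; ring.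
  by apply: idealB => //; apply: ideal_mull.
have {T1} /(regular_modX ru) T1 := T1.
have [t'' Tt'' [w'' e2]] : adjoin T u a'.
  by apply: ry; exists (y * a' - w * u) => //; exists w; rewrite subrK.
exists (t' + u ^+ e * t''); first by apply: idealD => //; apply: ideal_mull.
by exists w''; rewrite ea e2 exprS; ring.
Qed.

(* All rearrangements are needed to pass from [s] to the sequence of its powers. *)
Definition prime_sequence s := forall ys y zs, perm_eq s (ys ++ y :: zs) ->
  prime_ideal (lspan ys) /\ ~ lspan ys y.

Lemma prime_sequence_regularX s e : prime_sequence s ->
  forall l us y zs, perm_eq s (us ++ l ++ y :: zs) ->
  regular_mod (lspan ([seq z ^+ e | z <- l] ++ us)) y.
Proof.
move=> ps; elim=> [|u l IH] us y zs.
  by move=> /ps[hP Py] a /prime_ideal_mul; apply.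
move=> ps' /=; apply: regular_mod_adjoinX => //.
  apply: (IH us u (y :: zs)); apply: perm_trans ps' _.
  by rewrite perm_cat2l (perm_catCA [:: u] l).
rewrite (_ : adjoin _ _ = lspan ([seq z ^+ e | z <- l] ++ u :: us)).
  apply: (IH (u :: us) y zs); apply: perm_trans ps' _.
  by rewrite (perm_catCA us [:: u]).
rewrite -[adjoin _ _]/(lspan (u :: _)); apply: lspan_eqi => x.
by rewrite inE !mem_cat inE orbCA.
Qed.

End RegularSequences.

Section Local.
Variables (A : comPzRingType) (M : set A).
Hypotheses (noethA : noetherian A) (maxM : maximal_ideal M).
Hypothesis localA : forall J : set A, maximal_ideal J -> J = M.
Implicit Types (s ys zs : seq A).

Lemma local_unit a : ~ M a -> exists b, b * a = 1.
Proof.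
move=> Ma; have [[x -> [b]]|H] := pselect (lspan [:: a] 1).
  by rewrite add0r => ->; exists b.
have [N /localA -> aM] := proper_sub_maximal noethA (lspan_ideal _) H.
by case: Ma; apply: aM; apply: mem_lspan; rewrite mem_head.
Qed.

Lemma local_prime : prime_ideal M.
Proof.
have [hM M1 _] := maxM; split=> // x y Mxy.
rewrite orC; apply: contrapT => /not_orP[My Mx]; apply: My.
have [b bx] := local_unit Mx.
by rewrite -(mul1r y) -bx -mulrA; apply: ideal_mull.
Qed.

Lemma local_sat I : is_ideal I -> sat M I `<=` I.
Proof.
move=> hI a [t /local_unit[b bt] Ita].
by rewrite -(mul1r a) -bt -mulrA; apply: ideal_mull.
Qed.

Lemma regular_local_take_prime s k : M = lspan s -> has_prime_chain A (size s) ->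
  (k <= size s)%N -> prime_ideal (lspan (take k s)) /\
    ((k < size s)%N -> ~ lspan (take k s) (nth 0 s k)).
Proof.
move=> Ms [P [hP lP]]; have iM : is_ideal M by case: maxM.
have PM i : (i <= size s)%N -> P i `<=` M.
  move=> /hP hPi a Pa; apply: contrapT => /local_unit[b ba].
  by case: hPi => hPi P1 _; apply: P1; rewrite -ba; apply: ideal_mull.
pose P1 i := if i == size s then M else P i.
have cP1 : prime_chain (size s) P1.
  rewrite /P1; split=> i ilt; first by case: eqP => // _; [exact: local_prime|exact: hP].
  rewrite ltn_eqF//; have [ltP nltP] := lP i ilt.
  case: eqP => [ei|_]; last by split.
  have Pi : P i.+1 `<=` M by apply: PM.
  by split; [apply: subset_trans Pi|move=> MP; apply: nltP; apply: subset_trans MP].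
have [|Q [[hQ lQ] _ Qn Qk]] := prime_chain_through_seq noethA cP1.
  by move=> x xs; rewrite /P1 eqxx Ms; apply: mem_lspan.
have sQ i : (i <= size s)%N -> lspan (take i s) `<=` Q i.
  by move=> ile; apply: lspan_sub; [exact/prime_isideal/hQ|exact: Qk].
have take_S i : (i < size s)%N -> lspan (take i.+1 s) = adjoin (lspan (take i s)) (nth 0 s i).
  move=> ilt; rewrite (take_nth 0)// -[adjoin _ _]/(lspan (_ :: _)).
  by apply: lspan_eqi => x; rewrite mem_rcons.
have Qnth i : (i < size s)%N -> Q i.+1 `<=` lspan (take i.+1 s) -> ~ Q i (nth 0 s i).
  move=> ilt QS Qi; have [_ nl] := lQ i ilt; apply: nl.
  apply: subset_trans QS _; rewrite take_S//; apply: adjoin_sub => //.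
    by apply/prime_isideal/hQ/ltnW.
  exact/sQ/ltnW.
have Qs i : (i <= size s)%N -> Q i `<=` lspan (take i s).
  move=> ile; rewrite -(subKn ile); elim: (size s - i)%N (leq_subr i (size s)) => [|j IH] jlt.
    by rewrite subn0 take_size -Ms Qn /P1 eqxx.
  have {IH} := IH (ltnW jlt); rewrite -[(_ - j)%N](subnSK jlt).
  set m := (size s - j.+1)%N => IH.
  have mlt : (m < size s)%N by rewrite /m ltn_subrL (leq_trans _ jlt).
  have hQm := hQ m (ltnW mlt); have iQm := prime_isideal hQm.
  apply: subset_trans (local_sat _) => //.
  apply: (@nakayama_ideal _ noethA _ _ _ (nth 0 s m) local_prime) => //.
    by rewrite Ms; apply: mem_lspan; rewrite mem_nth.
  move=> a Qa; exists 1; first by case: maxM.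
  have : Q m.+1 a by case: (lQ m mlt) => + _; apply.
  move=> /IH; rewrite take_S// => -[z Iz [c e]].
  exists z => //; exists c; last by rewrite mul1r e mulrC.
  apply: (@prime_ideal_mul _ _ (nth 0 s m)) => //; last exact: Qnth.
  rewrite mulrC; apply: (idealDr iQm (sQ _ (ltnW mlt) _ Iz)).
  by rewrite -e.
move=> kle; have <- : Q k = lspan (take k s) by apply/seteqP; split; [exact: Qs|exact: sQ].
by split=> [|klt]; [exact: hQ|apply: Qnth => //; exact: Qs].
Qed.

Lemma regular_local_prime_sequence s : M = lspan s -> has_prime_chain A (size s) ->
  prime_sequence s.
Proof.
move=> Ms hs ys y zs sP.
have szs := perm_size sP; have Mys : M = lspan (ys ++ y :: zs).
  by rewrite Ms; apply: lspan_eqi; exact: perm_mem.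
have := @regular_local_take_prime (ys ++ y :: zs) (size ys) Mys.
rewrite -szs take_size_cat// nth_cat ltnn subnn /= => /(_ hs).
by rewrite szs size_cat /= leq_addr => /(_ isT)[? H]; split=> //; apply: H;
  rewrite addnS ltnS leq_addr.
Qed.

Section FrobeniusFree.
Variables (q n : nat) (b : 'I_n -> A) (s : seq A).
Hypothesis frobD : {morph (fun x : A => x ^+ q) : x y / x + y}.
Hypotheses (Ms : M = lspan s) (ps : prime_sequence s).
Hypothesis b_span : forall x, exists c : 'I_n -> A, x = \sum_i c i ^+ q * b i.
Hypothesis b_irredundant : forall c : 'I_n -> A, \sum_i c i ^+ q * b i = 0 ->
  forall i, M (c i).

Lemma frob0 : (0 : A) ^+ q = 0.
Proof. by apply: (addrI (0 ^+ q)); rewrite -frobD !addr0. Qed.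

Lemma frobB (x y : A) : (x - y) ^+ q = x ^+ q - y ^+ q.
Proof. by apply: (addIr (y ^+ q)); rewrite -frobD !subrK. Qed.

Lemma lspan_frob (l : seq A) a : lspan l a -> lspan [seq z ^+ q | z <- l] (a ^+ q).
Proof.
elim: l a => [|x l IH] a /=; first by move=> ->; rewrite frob0.
move=> [z /IH lz [c ->]]; exists (z ^+ q) => //; exists (c ^+ q).
by rewrite frobD exprMn.
Qed.

Lemma lspan_frob_coords (l : seq A) z : lspan [seq z ^+ q | z <- l] z ->
  exists2 e : 'I_n -> A, forall i, lspan l (e i) & z = \sum_i e i ^+ q * b i.
Proof.
elim: l z => [|x l IH] z /=.
  move=> ->; exists (fun=> 0) => //.
  by rewrite big1// => i _; rewrite frob0 mul0r.
move=> [y /IH[e le ->] [a ->]]; have [g ->] := b_span a.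
exists (fun i => e i + g i * x) => [i|].
  by exists (e i) => //; exists (g i).
rewrite mulr_suml -big_split /=; apply: eq_bigr => i _.
by rewrite frobD exprMn; ring.
Qed.

Lemma frobenius_coords_lspan zs ys : perm_eq s (ys ++ zs) -> forall c : 'I_n -> A,
  lspan [seq z ^+ q | z <- ys] (\sum_i c i ^+ q * b i) -> forall i, lspan ys (c i).
Proof.
elim: zs ys => [|x zs IH] ys sP.
  rewrite cats0 in sP; have Mys : M = lspan ys.
    by rewrite Ms; apply: lspan_eqi; exact: perm_mem.
  move=> c /lspan_frob_coords[e le] E i; rewrite -(subrK (e i) (c i)).
  apply: idealD => //; rewrite -Mys; apply: (b_irredundant (c := fun i => c i - e i)).
  under eq_bigr do rewrite frobB mulrBl.
  by rewrite sumrB -E subrr.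
(* The ideal [(X)] of all coordinates of [K] satisfies [(X) <= (ys) + x (X)]. *)
pose K := [set c : 'I_n -> A | lspan [seq z ^+ q | z <- ys] (\sum_i c i ^+ q * b i)].
pose X : set A := [set a | exists2 c, K c & exists i, a = c i].
have X_step c : K c -> exists2 w, K w & forall i, exists2 u, lspan ys u & c i = u + x * w i.
  move=> Kc.
  have cx i : exists uw : A * A, lspan ys uw.1 /\ c i = uw.1 + x * uw.2.
    have : lspan (rcons ys x) (c i).
      apply: IH; first by rewrite cat_rcons.
      by apply: lspan_mono Kc => y; rewrite map_rcons mem_rcons inE => ->; rewrite orbT.
    rewrite (@lspan_eqi _ _ (x :: ys)); last by move=> y; rewrite mem_rcons.
    by move=> [u yu [w ->]]; exists (u, w); rewrite mulrC.
  have [f fP] := choice cx; exists (fun i => (f i).2); last first.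
    by move=> i; exists (f i).1; have [] := fP i.
  have rx : regular_mod (lspan [seq z ^+ q | z <- ys]) (x ^+ q).
    rewrite -[[seq _ | _ <- _]]cats0; apply: regular_modX.
    exact: (prime_sequence_regularX (us := [::]) ps sP).
  apply: rx; apply: (idealDr (x := \sum_i (f i).1 ^+ q * b i)) => //.
    apply: ideal_sum => // i; apply: ideal_mulr => //.
    by apply: lspan_frob; have [] := fP i.
  rewrite mulr_sumr -big_split /=.
  rewrite (_ : \sum_i _ = \sum_i c i ^+ q * b i)//; apply: eq_bigr => i _.
  by have [_ ->] := fP i; rewrite frobD exprMn; ring.
pose Y : set A := [set a | exists2 z, lspan ys z & exists2 w, ideal_gen X w & a = z + x * w].
have XY : ideal_gen X `<=` Y.
  apply: ideal_gen_sub.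
    have iX := ideal_gen_ideal X; split.
    - by exists 0; [exact: ideal0|exists 0; [exact: ideal0|rewrite mulr0 addr0]].
    - move=> _ _ [z yz [w Xw ->]] [z' yz' [w' Xw' ->]]; exists (z + z'); first exact: idealD.
      by exists (w + w'); [exact: idealD iX _ _|ring].
    - move=> a _ [z yz [w Xw ->]]; exists (a * z); first exact: ideal_mull.
      by exists (a * w); [exact: ideal_mull iX _|ring].
  move=> _ [c /X_step[w Kw wP] [i ->]]; have [u yu ->] := wP i.
  by exists u => //; exists (w i) => //; apply: sub_ideal_gen; exists w => //; exists i.
have XS : ideal_gen X `<=` lspan ys.
  apply: subset_trans (local_sat _) => //.
  apply: (@nakayama_ideal _ noethA _ _ _ x local_prime) => //.
  - by rewrite Ms; apply: mem_lspan; rewrite (perm_mem sP) mem_cat mem_head orbT.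
  - exact: ideal_gen_ideal.
  - move=> y /XY[z yz [w Xw e]]; exists 1; first by case: maxM.
    by exists z => //; exists w => //; rewrite mul1r.
by move=> c Kc i; apply: XS; apply: sub_ideal_gen; exists c => //; exists i.
Qed.

Lemma frobenius_coords_free (c : 'I_n -> A) : \sum_i c i ^+ q * b i = 0 ->
  forall i, c i = 0.
Proof. by move=> E i; apply: (@frobenius_coords_lspan s [::]). Qed.

End FrobeniusFree.

End Local.

(** * Cartier maps *)

Section LocalizationTheory.
Variables (A : comPzRingType) (S : mulrClosed A).
Implicit Types (a b : A) (s t : denom S) (w : localization S).

Lemma locD a b s t : loc_frac a s + loc_frac b t =
  loc_frac (a * sval t + b * sval s) (mul_denom s t).
Proof. exact: loc_addE. Qed.

Lemma locM a b s t : loc_frac a s * loc_frac b t = loc_frac (a * b) (mul_denom s t).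
Proof. exact: loc_mulE. Qed.

Lemma toloc0 : toloc S 0 = 0. Proof. by []. Qed.

Lemma toloc1 : toloc S 1 = 1. Proof. by []. Qed.

Lemma tolocD a b : toloc S (a + b) = toloc S a + toloc S b.
Proof. by rewrite locD; apply: loc_frac_eq1 => /=; ring. Qed.

Lemma tolocM a b : toloc S (a * b) = toloc S a * toloc S b.
Proof. by rewrite locM; apply: loc_frac_eq1 => /=; ring. Qed.

Lemma tolocX a n : toloc S (a ^+ n) = toloc S a ^+ n.
Proof. by elim: n => [|n IH]; rewrite ?expr0 ?toloc1// !exprS tolocM IH. Qed.

Lemma toloc_sum (I : Type) (r : seq I) (P : pred I) (F : I -> A) :
  toloc S (\sum_(i <- r | P i) F i) = \sum_(i <- r | P i) toloc S (F i).
Proof. exact: (big_morph _ tolocD toloc0). Qed.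

Lemma toloc_eq a b : toloc S a = toloc S b -> exists2 u, u \in S & u * a = u * b.
Proof. by move=> /loc_frac_eq[u uS]; rewrite /= !mulr1 => e; exists u. Qed.

Lemma loc_frac_mul_denom a s : toloc S (sval s) * loc_frac a s = toloc S a.
Proof. by rewrite locM; apply: loc_frac_eq1 => /=; ring. Qed.

Lemma loc_inv_mul s : loc_frac 1 s * toloc S (sval s) = 1.
Proof. by rewrite mulrC loc_frac_mul_denom. Qed.

Lemma loc_frac_inv a s : loc_frac a s = toloc S a * loc_frac 1 s.
Proof. by rewrite locM; apply: loc_frac_eq1 => /=; ring. Qed.

Lemma toloc_mulI s : injective (fun w => toloc S (sval s) * w).
Proof.
by move=> w w' e; rewrite -(mul1r w) -(mul1r w') -(loc_inv_mul s) -!mulrA e.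
Qed.

Lemma common_denom n (c : 'I_n -> localization S) :
  exists2 s : A, s \in S & exists d : 'I_n -> A, forall i, toloc S s * c i = toloc S (d i).
Proof.
have cE i : exists x : A * denom S, c i = loc_frac x.1 x.2.
  by elim/loc_fracW: (c i) => a s; exists (a, s).
have [f fP] := choice cE; exists (\prod_i sval (f i).2).
  by apply: rpred_prod => i _; apply: valP.
exists (fun i => (\prod_(j | j != i) sval (f j).2) * (f i).1) => i.
rewrite (bigD1 i)//= mulrC !tolocM fP mulrA.
by rewrite (mulrC (loc_frac _ _)) loc_frac_mul_denom mulrC.
Qed.

Lemma loc_frobD q : {morph (fun x : A => x ^+ q) : x y / x + y} ->
  {morph (fun w : localization S => w ^+ q) : w w' / w + w'}.
Proof.
move=> frobD; elim/loc_fracW=> a s; elim/loc_fracW=> b t.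
set i := @loc_frac A S 1 (mul_denom s t).
have -> : loc_frac a s = toloc S (a * sval t) * i.
  by rewrite locM; apply: loc_frac_eq1 => /=; ring.
have -> : loc_frac b t = toloc S (b * sval s) * i.
  by rewrite locM; apply: loc_frac_eq1 => /=; ring.
by rewrite -mulrDl -tolocD !exprMn -!tolocX frobD tolocD mulrDl.
Qed.

End LocalizationTheory.

Section CartierMaps.
Variable A : comPzRingType.
Implicit Types (phi psi d : A -> A) (g h : A) (q : nat).

Definition cartier q phi := {morph phi : x y / x + y} /\
  forall a x, phi (a ^+ q * x) = a * phi x.

Definition frob_linear q d := {morph d : x y / x + y} /\
  forall a x, d (a ^+ q * x) = a ^+ q * d x.

Definition cartier_ideal q g : set A := [set y | exists2 phi, cartier q phi & y = phi g].

Definition frob_linear_orbit q g : set A :=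
  [set y | exists2 d, frob_linear q d & y = d g].

Lemma additive0 phi : {morph phi : x y / x + y} -> phi 0 = 0.
Proof. by move=> h; apply: (addrI (phi 0)); rewrite -h !addr0. Qed.

Lemma additive_sum phi (I : Type) (r : seq I) (P : pred I) (F : I -> A) :
  {morph phi : x y / x + y} ->
  phi (\sum_(i <- r | P i) F i) = \sum_(i <- r | P i) phi (F i).
Proof. by move=> h; apply: (big_morph phi h (additive0 h)). Qed.

Lemma cartier_comp_mull q phi a : cartier q phi -> cartier q (fun x => phi (a * x)).
Proof.
by move=> [D Z]; split=> [x y|b x]; rewrite ?mulrDr ?D// mulrCA Z.
Qed.

Lemma cartier_ideal_ideal q g : is_ideal (cartier_ideal q g).
Proof.
split.
- by exists (fun=> 0) => //; split=> [x y|a x]; rewrite ?addr0 ?mulr0.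
- move=> _ _ [f [fD fZ] ->] [f' [fD' fZ'] ->]; exists (fun x => f x + f' x) => //.
  by split=> [x y|a x]; [rewrite fD fD' addrACA|rewrite fZ fZ' mulrDr].
- move=> a _ [f [fD fZ] ->]; exists (fun x => a * f x) => //.
  by split=> [x y|b x]; [rewrite fD mulrDr|rewrite fZ mulrCA].
Qed.

Lemma frob_linear_orbit_ideal q g : is_ideal (frob_linear_orbit q g).
Proof.
split.
- by exists (fun=> 0) => //; split=> [x y|a x]; rewrite ?addr0 ?mulr0.
- move=> _ _ [f [fD fZ] ->] [f' [fD' fZ'] ->]; exists (fun x => f x + f' x) => //.
  by split=> [x y|a x]; [rewrite fD fD' addrACA|rewrite fZ fZ' mulrDr].
- move=> a _ [f [fD fZ] ->]; exists (fun x => a * f x) => //.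
  by split=> [x y|b x]; [rewrite fD mulrDr|rewrite fZ mulrCA].
Qed.

Lemma cartier_ideal_mull q a g : cartier_ideal q (a * g) `<=` cartier_ideal q g.
Proof.
by move=> _ [f cf ->]; exists (fun x => f (a * x)) => //; apply: cartier_comp_mull.
Qed.

Lemma cartier_ideal_orbit q g h : frob_linear_orbit q g h ->
  cartier_ideal q h `<=` cartier_ideal q g.
Proof.
move=> [d [dD dZ] ->] _ [f [fD fZ] ->]; exists (f \o d) => //.
by split=> [x y|a x] /=; rewrite ?dD ?fD ?dZ ?fZ.
Qed.

Lemma cartier_ideal_exp q q' g : {morph (fun x : A => x ^+ q') : x y / x + y} ->
  cartier_ideal q' 1 1 ->
  cartier_ideal (q * q') (g ^+ q') = cartier_ideal q g.
Proof.
move=> frobD [pi [piD piZ] pi1]; apply/seteqP; split.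
  move=> _ [f [fD fZ] ->]; exists (fun x => f (x ^+ q')) => //.
  by split=> [x y|a x]; [rewrite frobD fD|rewrite exprMn -exprM fZ].
move=> _ [f [fD fZ] ->]; exists (f \o pi) => /=; last first.
  by rewrite -(mulr1 (g ^+ q')) piZ -pi1 mulr1.
by split=> [x y|a x] /=; [rewrite piD fD|rewrite exprM piZ fZ].
Qed.

Definition dual_system q r n (b : 'I_n -> A) (phi : 'I_n -> A -> A) :=
  [/\ forall i, cartier q (phi i),
      forall x, r ^+ q * x = \sum_i phi i x ^+ q * b i &
      forall i j, phi i (b j) = if i == j then r else 0].

End CartierMaps.

Section CartierLocalization.
Variables (A : comPzRingType) (S : mulrClosed A) (q : nat).
Hypothesis q_gt0 : (0 < q)%N.
Variable phi : A -> A.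
Hypothesis phiC : cartier q phi.

Definition cartier_loc (w : localization S) : localization S :=
  loc_frac (phi ((repr w).1 * sval (repr w).2 ^+ q.-1)) (repr w).2.

Lemma cartier_locE a (s : denom S) :
  cartier_loc (loc_frac a s) = loc_frac (phi (a * sval s ^+ q.-1)) s.
Proof.
have [phiD phiZ] := phiC.
have [u uS] := loc_frac_eq (loc_frac_repr (loc_frac a s)).
rewrite /cartier_loc; move: (repr _) => [a' s'] /= e.
apply: loc_fracE; exists u => //.
rewrite ![phi _ * _]mulrC !mulrA -!phiZ; congr (phi _).
have qE : q = q.-1.+1 by rewrite prednK.
rewrite [X in (_ * _) ^+ X]qE [X in _ = _ ^+ X * _]qE !exprS !exprMn.
transitivity (u ^+ q.-1 * sval s ^+ q.-1 * sval s' ^+ q.-1 * (u * (a' * sval s))).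
  by ring.
by rewrite e; ring.
Qed.

Lemma cartier_loc_toloc a : cartier_loc (toloc S a) = toloc S (phi a).
Proof. by rewrite cartier_locE /= expr1n mulr1. Qed.

Lemma cartier_loc_cartier : cartier q cartier_loc.
Proof.
have [phiD phiZ] := phiC; have qE : q = q.-1.+1 by rewrite prednK.
split.
  elim/loc_fracW=> a s; elim/loc_fracW=> b t; rewrite locD !cartier_locE locD /=.
  congr loc_frac; rewrite exprMn ![phi _ * _]mulrC -!phiZ -phiD qE !exprS /=.
  by congr (phi _); ring.
have Z0 a w : cartier_loc (toloc S a ^+ q * w) = toloc S a * cartier_loc w.
  elim/loc_fracW: w => b s; rewrite -tolocX locM !cartier_locE locM -phiZ /=.
  by apply: loc_frac_eq1 => /=; rewrite !mul1r mulrA.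
elim/loc_fracW=> a s w; apply: (@toloc_mulI _ _ s).
by rewrite -Z0 mulrA -exprMn mulrA loc_frac_mul_denom Z0.
Qed.

End CartierLocalization.

Section RootIdeals.
Variables (R : comPzRingType) (p s : nat).
Hypothesis p_gt0 : (0 < p)%N.
Let q := (p ^ s)%N.

Lemma root_q_gt0 : (0 < q)%N. Proof. by rewrite expn_gt0 p_gt0. Qed.
Let q_gt0 := root_q_gt0.

Lemma cartier_ideal_sub_I (g : R) : cartier_ideal q g `<=` I_ p s g.
Proof.
move=> _ [phi phiC ->] r n b /(_ (to_loc_elt r g))[a [[ac aE] _]].
have [c cP] := choice ac; have [eD eZ] := cartier_loc_cartier (powers r) q_gt0 phiC.
rewrite /to_loc_elt -(cartier_loc_toloc _ q_gt0 phiC) -/(to_loc_elt r g).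
rewrite [X in cartier_loc _ _ X]aE.
have iI := ideal_gen_ideal [set c | exists a, pow_coords q b (to_loc_elt r g) a /\
  exists i, a i = c ^+ q].
rewrite additive_sum//; apply: (ideal_sum _ _ iI) => i; rewrite cP eZ.
apply: (ideal_mulr _ iI); apply: sub_ideal_gen.
by exists a; split=> //; exists i.
Qed.

Section OnDualSystem.
Variables (r : R) (n : nat) (b : 'I_n -> R) (phi : 'I_n -> R -> R).
Hypothesis dual : dual_system q r b phi.

Let psi i := cartier_loc (S := powers r) q (phi i).

Lemma dual_system_loc_coords w i (a : {ffun 'I_n -> loc_elt r}) c :
  pow_coords q (to_loc_elt r \o b) w a -> a i = c ^+ q ->
  psi i w = to_loc_elt r r * c.
Proof.
have [phiC _ phib] := dual; move=> [ac ->] ai.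
have [eD eZ] := cartier_loc_cartier (powers r) q_gt0 (phiC i).
rewrite /psi additive_sum// (bigD1 i)//= ai eZ /to_loc_elt cartier_loc_toloc// phib eqxx mulrC.
rewrite big1 ?addr0// => j ji; have [c' ->] := ac j.
by rewrite eZ cartier_loc_toloc// phib eq_sym (negbTE ji) toloc0 mulr0.
Qed.

Lemma dual_system_pow_basis : is_pow_basis q (to_loc_elt r \o b).
Proof.
have [phiC phix phib] := dual; move=> w.
have ir : loc_inv r * to_loc_elt r r = 1 by apply: loc_inv_mul.
have wE : to_loc_elt r r ^+ q * w = \sum_i psi i w ^+ q * to_loc_elt r (b i).
  elim/loc_fracW: w => a t; set w := loc_frac a t.
  have t_inj : injective (fun w => toloc (powers r) (sval t) ^+ q * w).
    rewrite -tolocX; have tq : sval t ^+ q \in powers r by apply/rpredX/valP.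
    exact: (@toloc_mulI _ _ (mk_denom tq)).
  apply: t_inj; rewrite /= mulrCA mulr_sumr.
  have -> : toloc (powers r) (sval t) ^+ q * w = toloc (powers r) (sval t ^+ q.-1 * a).
    by rewrite -[in LHS](prednK q_gt0) exprSr -mulrA loc_frac_mul_denom tolocM tolocX.
  rewrite /to_loc_elt -[toloc _ r ^+ q]tolocX -tolocM phix toloc_sum; apply: eq_bigr => i _.
  have [eD eZ] := cartier_loc_cartier (powers r) q_gt0 (phiC i).
  rewrite tolocM tolocX -(cartier_loc_toloc _ q_gt0 (phiC i)).
  rewrite mulrA -exprMn /psi -eZ; congr (cartier_loc _ _ _ ^+ _ * _).
  by rewrite -[in RHS](prednK q_gt0) exprSr -mulrA loc_frac_mul_denom tolocM tolocX.
exists [ffun i => (loc_inv r * psi i w) ^+ q]; split.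
  split=> [i|]; first by exists (loc_inv r * psi i w); rewrite ffunE.
  under eq_bigr do rewrite ffunE exprMn -mulrA.
  by rewrite -mulr_sumr -wE mulrA -exprMn ir expr1n mul1r.
move=> a wa; have [ac _] := wa; apply/ffunP => i; rewrite ffunE.
by have [c ci] := ac i; rewrite (dual_system_loc_coords wa ci) mulrA ir mul1r.
Qed.

Lemma I_sub_cartier_ideal_loc (g x : R) : I_ p s g x ->
  exists m, cartier_ideal q g (r ^+ m * x).
Proof.
have [phiC phix phib] := dual; have iC := cartier_ideal_ideal q g.
move=> /(_ r n _ dual_system_pow_basis).
pose J : set (loc_elt r) := [set w | exists m, exists2 a, cartier_ideal q g a &
  toloc (powers r) r ^+ m * w = toloc (powers r) a].
have iJ : is_ideal J.
  split.
  - by exists 0%N, 0; [exact: ideal0|rewrite mulr0].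
  - move=> w w' [m [a Ca e]] [m' [a' Ca' e']]; exists (m + m')%N.
    exists (r ^+ m' * a + r ^+ m * a'); first by apply: idealD => //; apply: ideal_mull.
    by rewrite tolocD !tolocM !tolocX -e -e' exprD; ring.
  - move=> w w' [m [a Ca e]]; elim/loc_fracW: w => c t.
    have /asboolP[k tk] := valP t.
    exists (k + m)%N, (c * a); first exact: ideal_mull.
    by rewrite exprD -tolocX -tk tolocM -e -(loc_frac_mul_denom c t); ring.
move=> /(@ideal_gen_sub _ _ J iJ)[].
  move=> c [a [ga [i ai]]]; exists 1%N, (phi i g); first by exists (phi i).
  by rewrite -(dual_system_loc_coords ga ai) /psi cartier_loc_toloc.
move=> m [a Ca]; rewrite -tolocX -tolocM => /toloc_eq[_ /asboolP[k ->] e].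
exists (k + m)%N; rewrite exprD -mulrA e; exact: ideal_mull.
Qed.

End OnDualSystem.

End RootIdeals.

Section DualSystems.
Variable R : comPzRingType.
Variable q : nat.
Hypothesis q_gt0 : (0 < q)%N.
Hypothesis noethR : noetherian R.
Hypothesis frobD : {morph (fun x : R => x ^+ q) : x y / x + y}.
Hypothesis pow_gen : exists N (w : 'I_N -> R),
  forall x, exists c : 'I_N -> R, x = \sum_i c i ^+ q * w i.

Let frob_sum (I : Type) (r : seq I) (P : pred I) (F : I -> R) :
  (\sum_(i <- r | P i) F i) ^+ q = \sum_(i <- r | P i) F i ^+ q.
Proof. exact: (additive_sum r P F frobD). Qed.

Lemma regular_local_free_pow (P : set R) (hP : prime_ideal P) :
  regular_local (loc_prime hP) ->
  exists n (b : 'I_n -> R),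
    (forall y, exists c : 'I_n -> loc_prime hP,
       y = \sum_i c i ^+ q * toloc (prime_compl hP) (b i)) /\
    (forall c : 'I_n -> loc_prime hP,
       \sum_i c i ^+ q * toloc (prime_compl hP) (b i) = 0 -> forall i, c i = 0).
Proof.
move=> [noethA [M [maxM uniqM [d [[hchain _] [x Mx]]]]]].
have frobA : {morph (fun w : loc_prime hP => w ^+ q) : w w' / w + w'} by apply: loc_frobD.
pose spans n (b : 'I_n -> R) := forall y, exists c : 'I_n -> loc_prime hP,
       y = \sum_i c i ^+ q * toloc (prime_compl hP) (b i).
have ex_spans : exists n, `[< exists b : 'I_n -> R, spans n b >].
  have [N [w wP]] := pow_gen; exists N; apply/asboolP; exists w.
  elim/loc_fracW=> a t; have [c cE] := wP (sval t ^+ q.-1 * a).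
  exists (fun i => loc_frac 1 t * toloc (prime_compl hP) (c i)).
  under eq_bigr do rewrite exprMn -tolocX -mulrA -tolocM.
  rewrite -mulr_sumr -toloc_sum -cE.
  rewrite tolocM tolocX loc_frac_inv; set i := loc_frac 1 t.
  have -> : i ^+ q = i * i ^+ q.-1 by rewrite -exprS prednK.
  by rewrite -mulrA (mulrA (_ ^+ _)) -exprMn loc_inv_mul expr1n mul1r mulrC.
case: (ex_minnP ex_spans) => n /asboolP[b bP] nmin.
exists n, b; split=> //.
apply: (@frobenius_coords_free _ M noethA maxM uniqM q n _ (codom x)) => //.
- by rewrite Mx ideal_gen_range.
- apply: (@regular_local_prime_sequence _ M) => //; first by rewrite Mx ideal_gen_range.
  by rewrite size_codom card_ord.
move=> c c0 i; apply: contrapT => /(local_unit noethA uniqM)[e ec].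
have : (n <= n.-1)%N.
  apply: nmin; apply/asboolP; exists (b \o lift i) => y; have [g ->] := bP y.
  exists (fun j => g (lift i j) - g i * e * c (lift i j)).
  move: c0; rewrite (bigD1_ord i)//= => /eqP; rewrite addr_eq0 => /eqP c0.
  rewrite (bigD1_ord i)//=.
  rewrite -[g i]mulr1 -{1}ec mulrA exprMn -[(_ * _) ^+ q * _ * _]mulrA c0.
  rewrite mulr1 mulrN mulr_sumr.
  rewrite addrC -sumrB; apply: eq_bigr => j _.
  by rewrite (frobB frobA) !exprMn; ring.
by case: n i {b bP nmin c c0 e ec} => [[]//|m _]; rewrite ltnn.
Qed.

Lemma torsion_annihilator (P : set R) : prime_ideal P ->
  exists2 u, ~ P u & forall a, sat P [set 0] a -> u * a = 0.
Proof.
move=> hP; have hS := sat_ideal hP (lspan_ideal [::]).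
have [l lE] := noetherian_lspan noethR hS.
have [u Pu uP] : exists2 u, ~ P u & forall a, a \in l -> u * a = 0.
  have : forall a, a \in l -> sat P [set 0] a by move=> a al; rewrite lE; apply: mem_lspan.
  elim: {lE} l => [|y l IH] lS; first by exists 1 => //; case: hP.
  have [|u Pu uP] := IH; first by move=> a al; apply: lS; rewrite inE al orbT.
  have [v Pv vy] := lS y (mem_head _ _); exists (u * v); first exact: primeM.
  move=> a; rewrite inE => /orP[/eqP ->|/uP ua]; first by rewrite -mulrA vy mulr0.
  by rewrite mulrAC ua mul0r.
exists u => // a; rewrite lE; apply: (@lspan_sub _ [set a | u * a = 0]) => //.
split=> /=; first by rewrite mulr0.
  by move=> y z uy uz; rewrite mulrDr uy uz addr0.
by move=> y z uz; rewrite mulrCA uz mulr0.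
Qed.

Lemma regular_dual_system (P : set R) (hP : prime_ideal P) :
  regular_local (loc_prime hP) ->
  exists2 r, ~ P r & exists n (b : 'I_n -> R) phi, dual_system q r b phi.
Proof.
move=> /regular_local_free_pow[n [b [b_span b_free]]].
have [u Pu uP] := torsion_annihilator hP.
have b_indep (c : 'I_n -> R) : \sum_i c i ^+ q * b i = 0 -> forall i, u * c i = 0.
  move=> c0 i; apply: uP.
  have /toloc_eq[v /asboolP Pv] : toloc (prime_compl hP) (c i) = toloc (prime_compl hP) 0.
    apply: (b_free (toloc (prime_compl hP) \o c)).
    by under eq_bigr do rewrite /= -tolocX -tolocM; rewrite -toloc_sum c0 toloc0.
  by rewrite mulr0 => vc; exists v.
have coords1 x : exists2 t, ~ P t & exists c : 'I_n -> R, t ^+ q * x = \sum_i c i ^+ q * b i.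
  have [c cE] := b_span (toloc _ x).
  have [t tS [d dE]] := common_denom c.
  have : toloc (prime_compl hP) (t ^+ q * x) = toloc (prime_compl hP) (\sum_i d i ^+ q * b i).
    rewrite tolocM tolocX cE toloc_sum mulr_sumr; apply: eq_bigr => i _.
    by rewrite tolocM tolocX -dE exprMn mulrA.
  move=> /toloc_eq[v /asboolP Pv e]; exists (v * t).
    by apply: primeM => //; move: tS => /asboolP.
  exists (fun i => v * d i); under eq_bigr do rewrite exprMn -mulrA.
  have vq : v ^+ q = v ^+ q.-1 * v by rewrite -exprSr prednK.
  by rewrite -mulr_sumr exprMn -mulrA vq -!mulrA e.
have [t Pt tE] : exists2 t, ~ P t & forall x, exists c : 'I_n -> R,
    t ^+ q * x = \sum_i c i ^+ q * b i.
  have [N [w wP]] := pow_gen.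
  have wt j : exists z : R * ('I_n -> R), ~ P z.1 /\
      z.1 ^+ q * w j = \sum_i z.2 i ^+ q * b i.
    by have [tj Ptj [c cE]] := coords1 (w j); exists (tj, c).
  have [f fP] := choice wt.
  exists (\prod_j (f j).1).
    apply: (big_ind (fun t => ~ P t)); first by have [] := hP.
      by move=> y z; apply: primeM.
    by move=> j _; have [] := fP j.
  move=> x; have [c ->] := wP x.
  exists (fun i => \sum_j c j * (\prod_(k | k != j) (f k).1) * (f j).2 i).
  transitivity (\sum_i \sum_j (c j * (\prod_(k | k != j) (f k).1) * (f j).2 i) ^+ q * b i);
    last by apply: eq_bigr => i _; rewrite frob_sum mulr_suml.
  rewrite exchange_big mulr_sumr; apply: eq_bigr => j _ /=.
  under [RHS]eq_bigr do rewrite exprMn -mulrA.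
  rewrite -mulr_sumr; have [_ <-] := fP j.
  by rewrite (bigD1 j)//= !exprMn; ring.
have [c cE] := choice tE.
pose phi i x := u * c x i.
have cB x (d : 'I_n -> R) : t ^+ q * x = \sum_i d i ^+ q * b i ->
    forall i, u * c x i = u * d i.
  move=> dE i; apply/eqP; rewrite -subr_eq0 -mulrBr; apply/eqP.
  apply: (b_indep (fun i => c x i - d i)).
  by under eq_bigr do rewrite (frobB frobD) mulrBl; rewrite sumrB -cE -dE subrr.
exists (u * t); first exact: primeM.
exists n, b, phi; split.
- move=> i; split=> [x y|a x]; rewrite /phi.
    rewrite -mulrDr; apply: (cB _ (fun i => c x i + c y i)).
    by rewrite mulrDr !cE -big_split; apply: eq_bigr => j _; rewrite frobD mulrDl.
  rewrite mulrCA; apply: (cB _ (fun i => a * c x i)).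
  by rewrite mulrCA cE mulr_sumr; apply: eq_bigr => j _; rewrite exprMn mulrA.
- move=> x; rewrite exprMn -mulrA cE mulr_sumr; apply: eq_bigr => i _.
  by rewrite /phi exprMn mulrA.
- move=> i j; rewrite /phi (cB _ (fun i => if i == j then t else 0)).
    by case: eqP => _; rewrite ?mulr0.
  rewrite (bigD1 j)//= eqxx big1 ?addr0// => k /negbTE ->.
  by rewrite (additive0 frobD) mul0r.
Qed.

End DualSystems.

Section RegularRings.
Variables (R : comPzRingType) (q : nat).
Hypothesis q_gt0 : (0 < q)%N.
Hypothesis noethR : noetherian R.
Hypothesis dualR : forall P : set R, prime_ideal P -> 
  exists2 r, ~ P r & exists n (b : 'I_n -> R) phi, dual_system q r b phi.

Lemma ideal1_locally (I : set R) : is_ideal I ->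
  (forall r n (b : 'I_n -> R) phi, dual_system q r b phi -> exists m, I (r ^+ m)) -> I 1.
Proof.
move=> hI H; apply: contrapT => /(proper_sub_prime noethR hI)[P hP IP].
have [r Pr [n [b [phi /H[m /IP]]]]] := dualR hP.
exact: (primeX hP Pr).
Qed.

Lemma cartier_ideal_split : cartier_ideal q 1 (1 : R).
Proof.
apply: ideal1_locally; first exact: cartier_ideal_ideal.
move=> r n b phi [phiC phix _]; exists q; rewrite -(mulr1 (r ^+ q)) phix.
apply: ideal_sum => [|i]; first exact: cartier_ideal_ideal.
apply: ideal_mulr; first exact: cartier_ideal_ideal.
have -> : phi i 1 ^+ q = phi i 1 * phi i 1 ^+ q.-1 by rewrite -exprS prednK.
apply: ideal_mulr; first exact: cartier_ideal_ideal.
by exists (phi i).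
Qed.

Lemma frob_linear_orbitP (g h : R) :
  {morph (fun x : R => x ^+ q) : x y / x + y} ->
  cartier_ideal q h `<=` cartier_ideal q g -> frob_linear_orbit q g h.
Proof.
move=> frobD hg; have iD := frob_linear_orbit_ideal q g.
suff : colon (frob_linear_orbit q g) h 1 by rewrite /colon /= mul1r.
apply: ideal1_locally; first exact: colon_ideal.
move=> r n b phi [phiC phix _]; exists q; rewrite /colon /= phix.
apply: ideal_sum => // i.
have [|psi [psiD psiZ] ->] := hg (phi i h); first by exists (phi i).
exists (fun x => psi x ^+ q * b i) => //; split=> [x y|a x].
  by rewrite psiD frobD mulrDl.
by rewrite psiZ exprMn mulrA.
Qed.

End RegularRings.

Lemma I_cartier_ideal (R : comPzRingType) (p s : nat) (g : R) : (0 < p)%N ->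
  noetherian R ->
  (forall P : set R, prime_ideal P ->
    exists2 r, ~ P r & exists n (b : 'I_n -> R) phi, dual_system (p ^ s) r b phi) ->
  I_ p s g = cartier_ideal (p ^ s) g.
Proof.
move=> p_gt0 noethR dualR; apply/seteqP; split; last exact: cartier_ideal_sub_I.
move=> x Ix; suff : colon (cartier_ideal (p ^ s) g) x 1 by rewrite /colon /= mul1r.
apply: (ideal1_locally noethR dualR); first exact/colon_ideal/cartier_ideal_ideal.
move=> r n b phi dual; exact: (I_sub_cartier_ideal_loc p_gt0 dual Ix).
Qed.

(** * Differential operators *)

Section Commutators.
Variable R : comNzRingType.
Implicit Types (d : R -> R) (r : R).

Definition ad r d : R -> R := fun x => d (r * x) - r * d x.

Lemma iter_ad n r d x : iter n (ad r) d x =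
  \sum_(i < n.+1) (('X - r%:P) ^+ n)`_i * d (r ^+ i * x).
Proof.
elim: n d => [|n IH] d; first by rewrite big_ord_recl big_ord0 expr0 coef1 mul1r addr0 mul1r.
rewrite iterSr IH; set P := ('X - r%:P) ^+ n.
have P_n1 : P`_n.+1 = 0 by apply: nth_default; rewrite size_exp_XsubC.
transitivity (\sum_(i < n.+1) P`_i * d (r ^+ i.+1 * x) -
              r * \sum_(i < n.+2) P`_i * d (r ^+ i * x)).
  rewrite [X in _ - _ * X]big_ord_recr /= P_n1 mul0r addr0 mulr_sumr -sumrB.
  by apply: eq_bigr => i _; rewrite /ad exprS -mulrA; ring.
transitivity (\sum_(i < n.+2) (('X * P)`_i - r * P`_i) * d (r ^+ i * x)).
  under [RHS]eq_bigr do rewrite mulrBl -mulrA.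
  rewrite sumrB -mulr_sumr; congr (_ - _).
  by rewrite [RHS]big_ord_recl coefXM mul0r add0r; apply: eq_bigr => i _; rewrite coefXM.
by apply: eq_bigr => i _; rewrite exprS [('X - _) * _]mulrBl coefB coefCM.
Qed.

Lemma iter_ad_frob p s r d x : p \in [pchar R] ->
  iter (p ^ s) (ad r) d x = d (r ^+ (p ^ s) * x) - r ^+ (p ^ s) * d x.
Proof.
move=> hp; rewrite iter_ad; set q := (p ^ s)%N.
have q_gt0 : (0 < q)%N by rewrite expn_gt0 prime_gt0 ?(pcharf_prime hp).
have -> : ('X - r%:P) ^+ q = 'X^q - (r ^+ q)%:P.
  have hp' : p \in [pchar {poly R}] by rewrite pchar_poly.
  rewrite -[in RHS](subrK (r%:P) 'X) [in RHS]exprDn_pchar ?polyC_exp ?addrK//.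
  by rewrite /q pnatX (pnatE _ (pcharf_prime hp)) hp'.
rewrite -(prednK q_gt0) big_ord_recr big_ord_recl /= big1 => [|i _].
  rewrite addr0 addrC !coefB !coefXn !coefC eqxx /= subr0 mul1r expr0 mul1r sub0r mulNr.
  by [].
rewrite coefB coefXn coefC /bump /= add1n eqSS ltn_eqF// subrr mul0r //.
Qed.

Lemma ad0 r : ad r (fun=> 0) = (fun=> 0).
Proof. by apply/funext => x; rewrite /ad mulr0 subrr. Qed.

Lemma ad_comm r r' d : ad r (ad r' d) = ad r' (ad r d).
Proof. by apply/funext => x; rewrite /ad (mulrCA r' r); ring. Qed.

Lemma iter_ad_comm n r r' d : iter n (ad r) (ad r' d) = ad r' (iter n (ad r) d).
Proof. by elim: n => // n IH; rewrite !iterS IH ad_comm. Qed.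

Lemma iter_ad_diffop n r d : diffop_le n d -> iter n.+1 (ad r) d = (fun=> 0).
Proof.
elim: n d => [|n IH] d.
  by move=> [c ->]; apply/funext => x /=; rewrite /ad mulrCA subrr.
by move=> [_ /(_ r)]; rewrite iterSr; apply: IH.
Qed.

Lemma diffop_frob_linear p s n d : p \in [pchar R] -> diffop_le n d -> (n < p ^ s)%N ->
  frob_linear (p ^ s) d.
Proof.
move=> hp dn ns; split=> [|a x]; first exact: diffop_le_add dn.
apply/eqP; rewrite -subr_eq0 -iter_ad_frob// -(subnK ns) iterD (iter_ad_diffop _ dn).
by have -> : forall m, iter m (ad a) (fun=> 0) = (fun=> 0) by elim=> //= m ->; rewrite ad0.
Qed.

Lemma diffop_le0 n : diffop_le n (fun=> 0 : R).
Proof.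
by apply: (@diffop_le_leq _ 0) => //; exists 0; apply/funext => x; rewrite mul0r.
Qed.

Lemma diffop_le_sum n (I : Type) (l : seq I) (F : I -> R -> R) :
  (forall i, diffop_le n (F i)) -> diffop_le n (fun x => \sum_(i <- l) F i x).
Proof.
move=> Fn; elim: l => [|i l IH].
  by under eq_fun do rewrite big_nil; exact: diffop_le0.
under eq_fun do rewrite big_cons.
exact: diffop_leD.
Qed.

Lemma frob_linear_ad q r d : frob_linear q d -> frob_linear q (ad r d).
Proof.
by move=> [dD dZ]; split=> [x y|a x]; rewrite /ad; [rewrite !mulrDr !dD; ring|
  rewrite mulrCA !dZ; ring].
Qed.

(* If some [k j] vanishes then [d = 0]; otherwise [ad (w j) d] satisfies the *)
(* hypotheses with [k j] decreased, and [ad r d] is a combination of these. *)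
Lemma diffop_le_nilpotent_ad q N (w : 'I_N -> R) K (k : 'I_N -> nat) d :
  (forall x, exists c : 'I_N -> R, x = \sum_i c i ^+ q * w i) ->
  frob_linear q d -> (forall j, iter (k j) (ad (w j)) d = (fun=> 0)) ->
  (\sum_j k j <= K)%N -> diffop_le K d.
Proof.
move=> wP; elim: K k d => [|K IH] k d dq dk kK.
  suff -> : d = (fun=> 0) by exact: diffop_le0.
  case: N w k wP dk kK => [|N] w k wP dk kK.
    by apply/funext => x; have [c ->] := wP (d x); rewrite big_ord0.
  move: (dk ord0) kK; rewrite (bigD1 ord0)//= leqn0 addn_eq0 => + /andP[/eqP k0 _].
  by rewrite k0.
have [[j /eqP kj]|k_gt0] := pselect (exists j, k j == 0%N).
  have -> : d = (fun=> 0) by have := dk j; rewrite kj.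
  exact: diffop_le0.
have [dD dZ] := dq; split=> // r; have [c ->] := wP r.
have -> : (fun x => d ((\sum_i c i ^+ q * w i) * x) - (\sum_i c i ^+ q * w i) * d x) =
    (fun x => \sum_i c i ^+ q * ad (w i) d x).
  apply/funext => x; rewrite !mulr_suml additive_sum// -sumrB.
  by apply: eq_bigr => i _; rewrite /ad -mulrA dZ mulrBr mulrA.
apply: diffop_le_sum => j; apply: diffop_le_mull.
have kj : (0 < k j)%N by rewrite lt0n; apply/negP => kj; apply: k_gt0; exists j.
apply: (IH (fun i => if i == j then (k j).-1 else k i)).
- exact: frob_linear_ad.
- move=> i; case: eqP => [->|_]; last by rewrite iter_ad_comm dk ad0.
  by rewrite -iterSr prednK.
- rewrite -ltnS (leq_trans _ kK)// (bigD1 j)//= eqxx [X in (_ < X)%N](bigD1 j)//=.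
  rewrite (eq_bigr k) => [|i /negbTE ->//].
  by rewrite ltn_add2r prednK.
Qed.

Lemma frob_linear_diffop p s N (w : 'I_N -> R) d : p \in [pchar R] ->
  (forall x, exists c : 'I_N -> R, x = \sum_i c i ^+ (p ^ s) * w i) ->
  frob_linear (p ^ s) d -> d \in @diffop_pred R.
Proof.
move=> hp wP dq; apply/asboolP; exists (\sum_(j < N) p ^ s)%N.
apply: (diffop_le_nilpotent_ad (k := fun=> (p ^ s)%N) wP dq) => // j.
by apply/funext => x; have [_ dZ] := dq; rewrite iter_ad_frob// dZ subrr.
Qed.

End Commutators.

Lemma F_finite_pow_gen (R : comPzRingType) (p s : nat) :
  (forall n, {morph (fun x : R => x ^+ (p ^ n)) : x y / x + y}) -> F_finite R p ->
  exists N (w : 'I_N -> R), forall x, exists c : 'I_N -> R, x = \sum_i c i ^+ (p ^ s) * w i.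
Proof.
move=> frobD [n [b bP]]; have {}bP x : exists c : 'I_n -> R, x = \sum_i c i ^+ p * b i.
  have [a [ac ->]] := bP x; have [c cE] := choice ac.
  by exists c; apply: eq_bigr => i _; rewrite cE.
suff [I [w wP]] : exists (I : finType) (w : I -> R), forall x,
    exists c : I -> R, x = \sum_i c i ^+ (p ^ s) * w i.
  exists #|I|, (w \o enum_val) => x; have [c ->] := wP x; exists (c \o enum_val).
  by rewrite (reindex_onto enum_val enum_rank)/=; [apply: eq_bigl => i; rewrite enum_valK eqxx|
    move=> i _; rewrite enum_rankK].
elim: s => [|s [I [w wP]]].
  by exists 'I_1, (fun=> 1) => x; exists (fun=> x); rewrite big_ord1 expr1 mulr1.
exists ('I_n * I)%type, (fun z => w z.2 ^+ p * b z.1) => x.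
have [c ->] := bP x.
have cw i : exists e : I -> R, c i = \sum_j e j ^+ (p ^ s) * w j by [].
have [e eE] := choice cw.
exists (fun z => e z.1 z.2).
rewrite -(pair_bigA _ (fun i j => e i j ^+ (p ^ s.+1) * (w j ^+ p * b i))).
apply: eq_bigr => i _; rewrite eE -[p in LHS]expn1 (additive_sum _ _ _ (frobD 1%N)) mulr_suml.
by apply: eq_bigr => j _; rewrite exprMn -exprM expn1 expnSr mulrA.
Qed.

Section LocalizedModule.
Variables (R : comPzRingType) (f : R) (act : diffop R -> loc_elt f -> loc_elt f).
Hypothesis hact : is_loc_dmodule act.

Lemma loc_act_inv q (D : diffop R) : (0 < q)%N -> frob_linear q D ->
  to_loc_elt f (f ^+ q) * act D (loc_inv f) = to_loc_elt f (D (f ^+ q.-1)).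
Proof.
move=> q_gt0 [_ DZ]; have [[actM _ _ _] actm actl] := hact.
rewrite -actm -actM (_ : mulop (f ^+ q) * D = D * mulop (f ^+ q)).
  rewrite actM actm -actl; congr (act D _).
  have fi : loc_inv f * toloc (powers f) f = 1 by apply: loc_inv_mul.
  by rewrite -[in LHS](prednK q_gt0) exprSr /to_loc_elt tolocM -mulrA (mulrC _ (loc_inv f))
    fi mulr1.
by apply: diffop_eq => x /=; rewrite DZ.
Qed.

End LocalizedModule.

Theorem corollary3p6 (R : comNzRingType) (p : nat) (hp : p \in [pchar R])
    (hreg : regular_ring R) (hfin : F_finite R p) (f : R)
    (act : diffop R -> loc_elt f -> loc_elt f) (hact : is_loc_dmodule act) :
  (exists N : nat, (1 <= N)%N /\
     forall s : nat, (N <= s)%N ->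
       I_ p s (f ^+ (p ^ s - 1)) = I_ p N (f ^+ (p ^ N - 1)))
  <-> (forall m : loc_elt f, exists d : diffop R, m = act d (loc_inv f)).
Proof.
have p_prime := pcharf_prime hp; have p_gt0 := prime_gt0 p_prime.
have p_gt1 := prime_gt1 p_prime.
have q_gt0 s : (0 < p ^ s)%N by rewrite expn_gt0 p_gt0.
have frobD s : {morph (fun x : R => x ^+ (p ^ s)) : x y / x + y}.
  by move=> x y; rewrite exprDn_pchar// pnatX (pnatE _ p_prime) hp.
have [noethR hloc] := hreg.
have gen s := F_finite_pow_gen s frobD hfin.
have dual s (P : set R) (hP : prime_ideal P) :=
  regular_dual_system (q_gt0 s) noethR (frobD s) (gen s) (hloc P hP).
have IE s (g : R) := I_cartier_ideal g p_gt0 noethR (@dual s).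
have Cexp s k (g : R) : cartier_ideal (p ^ (s + k)) (g ^+ (p ^ k)) = cartier_ideal (p ^ s) g.
  rewrite expnD; apply: cartier_ideal_exp; first exact: frobD.
  exact: (cartier_ideal_split (q_gt0 k) noethR (@dual k)).
have fi : loc_inv f * to_loc_elt f f = 1 by apply: loc_inv_mul.
have finv n : loc_inv f ^+ n * to_loc_elt f (f ^+ n) = 1.
  by rewrite /to_loc_elt tolocX -exprMn fi expr1n.
have finj n (w w' : loc_elt f) :
    to_loc_elt f (f ^+ n) * w = to_loc_elt f (f ^+ n) * w' -> w = w'.
  by move=> e; rewrite -(mul1r w) -(mul1r w') -(finv n) -!mulrA e.
split.
- move=> [N [_ stab]]; elim/loc_fracW=> a t; have /asboolP[n tn] := valP t.
  set Q := (p ^ (N + n))%N.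
  have [D0 D0l D0f] : frob_linear_orbit Q (f ^+ (Q - 1)) (f ^+ (Q - p ^ n)).
    apply: (frob_linear_orbitP noethR (@dual (N + n)%N)) => //.
    rewrite -[X in _ `<=` X]IE stab ?leq_addr// IE -(Cexp N n) -exprM mulnBl mul1n -expnD.
    by [].
  have [M [w wP]] := gen (N + n)%N.
  pose D := DiffOp (frob_linear_diffop hp wP D0l).
  exists (mulop (a * f ^+ (p ^ n - n)) * D).
  have [[actM _ _ _] actm _] := hact.
  have pnQ : (p ^ n <= Q)%N by rewrite leq_exp2l// leq_addl.
  have npn : (n <= p ^ n)%N by rewrite ltnW// ltn_expl.
  apply: (finj Q); rewrite actM actm mulrCA (loc_act_inv (q := Q) (D := D) hact (q_gt0 _) D0l).
  rewrite -subn1 -[D _]D0f /to_loc_elt -tolocM -mulrA -exprD.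
  rewrite addnC addnBA// subnK// -[in LHS](subnK (leq_trans npn pnQ)) exprD.
  have frac_mul x : toloc (powers f) (x * sval t) * loc_frac a t = toloc (powers f) (a * x).
    by rewrite !tolocM -mulrA loc_frac_mul_denom mulrC.
  by rewrite -tn; exact: frac_mul.
- move=> gen1; have [d dE] := gen1 (loc_inv f ^+ p).
  have /asboolP[n dn] := diffopP d; set Q0 := (p ^ n.+1)%N.
  have nQ s : (n < s)%N -> (n < p ^ s)%N by move=> ns; rewrite (ltn_trans ns)// ltn_expl.
  have dl s : (n < s)%N -> frob_linear (p ^ s) d.
    by move=> /nQ; exact: diffop_frob_linear.
  have pQ s : (0 < s)%N -> (p <= p ^ s)%N by move=> s0; rewrite -{1}(expn1 p) leq_exp2l.
  have e1 : to_loc_elt f (f ^+ Q0) * loc_inv f ^+ p = to_loc_elt f (f ^+ (Q0 - p)).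
    apply: (finj p); rewrite mulrCA [_ * (loc_inv f ^+ p)]mulrC finv mulr1.
    by rewrite /to_loc_elt -tolocM -exprD subnKC// pQ.
  have := loc_act_inv (D := d) hact (q_gt0 _) (dl n.+1 (ltnSn n)).
  rewrite -dE e1.
  move=> /toloc_eq[_ /asboolP[m ->] em].
  (* [R -> R_f] need not be injective; the [f]-torsion is killed by the extra *)
  (* factor [f ^+ e], which [d] commutes with. *)
  have key j : (m <= j)%N -> d (f ^+ (p ^ (n.+1 + j) - 1)) = f ^+ (p ^ (n.+1 + j) - p).
    move=> mj; set e := ((p ^ j - 1) * Q0)%N.
    have QE : (p ^ (n.+1 + j) = e + Q0)%N.
      by rewrite /e mulnBl mul1n subnK ?leq_pmull// mulnC -expnD.
    have me : (m <= e)%N.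
      rewrite (leq_trans mj)// (leq_trans _ (leq_pmulr _ (q_gt0 _)))//.
      by rewrite leq_subRL// add1n ltn_expl.
    have [_ dZ] := dl n.+1 (ltnSn n).
    rewrite QE -!addnBA ?pQ ?q_gt0//.
    rewrite !exprD subn1 exprM dZ -exprM -/e -(subnK me) exprD -!mulrA.
    by rewrite em.
  have step s : (n.+1 + m <= s)%N ->
      I_ p s.+1 (f ^+ (p ^ s.+1 - 1)) = I_ p s (f ^+ (p ^ s - 1)).
    move=> ns; rewrite !IE -[RHS](Cexp s 1%N) addn1 expn1 -exprM mulnBl mul1n -expnSr.
    apply/seteqP; split.
      have -> : (p ^ s.+1 - 1 = (p - 1) + (p ^ s.+1 - p))%N.
        by rewrite addnC addnBA// subnK// pQ.
      by rewrite exprD; exact: cartier_ideal_mull.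
    apply: cartier_ideal_orbit; exists (d : R -> R).
      by apply: dl; rewrite ltnS (leq_trans _ ns)// ltnW// ltn_addr.
    have sE : s.+1 = (n.+1 + (s.+1 - n.+1))%N.
      by rewrite subnKC// ltnS (leq_trans _ ns)// ltnW// ltn_addr.
    rewrite sE key// leq_subRL; first exact: leqW.
    by rewrite ltnS (leq_trans _ ns)// ltnW// ltn_addr.
  exists (n.+1 + m)%N; split=> // s /subnK <-.
  elim: (s - _)%N => // k IH.
  by rewrite addSn step// leq_addl.
Qed.
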